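(* There exist convex bodies $C$ for which the degree $d$ of the algebraic boundary of $C^o$ is arbitrarily large and $\operatorname{rank}_{\mathrm{psd}}(C) \leq \sqrt{20 \log d}$. That is, for every $D\in\mathbb{N}$ there exist $k\ge 1$ and a convex body $C\subseteq\mathbb{R}^k$ such that, with $d = \deg(\partial_a C^o)$, one has $d \geq D$ and $\operatorname{rank}_{\mathrm{psd}}(C) \leq \sqrt{20\log d}$.
   Context: A convex body in $\mathbb{R}^k$ is a closed convex set $C\subseteq\mathbb{R}^k$ such that the origin lies in the interior of $C$. Its polar is $C^o = \{ c \in \mathbb{R}^k : \langle c,x \rangle \leq 1 \ \forall x \in C\}$. The boundary of a set $D$ is $\partial D = \mathrm{cl}(D)\setminus \mathrm{int}(D)$, and the algebraic boundary $\partial_a D$ of $D\subseteq\mathbb{R}^k$ is the smallest affine algebraic variety in $\mathbb{C}^k$ containing $\partial D$. When $\partial_a D$ is a hypersurface, its degree is the smallest degree of a nonzero polynomial vanishing on it (equivalently, on $\partial D$). $\log$ denotes the logarithm in base 2. A spectrahedron defined using $m\times m$ matrices is a set of the form $S = \{ x \in \mathbb{R}^n : A_0 + x_1 A_1 + \dots + x_n A_n \succeq 0\}$, where $A_0,\dots,A_n$ are real symmetric $m\times m$ matrices and $M\succeq 0$ means $M$ is positive semidefinite. A convex set $C\subseteq\mathbb{R}^k$ has a semidefinite lift of size $m$ if $C=\pi(S)$ for some spectrahedron $S\subseteq\mathbb{R}^n$ (some $n$) defined using $m\times m$ matrices and some linear map $\pi:\mathbb{R}^n\to\mathbb{R}^k$.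 The positive semidefinite rank $\operatorname{rank}_{\mathrm{psd}}(C)$ is the smallest $m$ such that $C$ has a semidefinite lift of size $m$. *)

(* Defs.v *)
(* mpoly is not fully imported: its notations clash with those of
   mathcomp-analysis. *)
From HB Require Import structures.
From mathcomp Require Import all_boot all_order all_algebra.
From mathcomp Require Import all_classical all_reals all_analysis.
From mathcomp Require Import complex.
From mathcomp Require mpoly.
Import (canonicals, coercions, hints) mpoly.

Set Implicit Arguments.
Unset Strict Implicit.
Unset Printing Implicit Defensive.

Import Order.TTheory GRing.Theory Num.Theory.
Import numFieldNormedType.Exports.

Local Open Scope classical_set_scope.
Local Open Scope ring_scope.
Local Open Scope complex_scope.

Definition log2 (R : realType) (x : R) : R := ln x / ln 2.

Section ConvexBodies.
Context {R : realType} {k : nat}.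

(* Possibly unbounded. The topology on 'rV[R]_k is that of the sup norm. *)
Definition convex_body (C : set 'rV[R]_k) : Prop :=
  [/\ closed C,
      convex_set (C : set (convex_lmodType 'rV[R]_k)) &
      interior C 0].

Definition inner (c x : 'rV[R]_k) : R := \sum_(i < k) c 0 i * x 0 i.

Definition polar (C : set 'rV[R]_k) : set 'rV[R]_k :=
  [set c | forall x, C x -> inner c x <= 1].

Definition boundary (D : set 'rV[R]_k) : set 'rV[R]_k :=
  closure D `\` interior D.

End ConvexBodies.

Section AlgebraicSets.
Context {K : fieldType} {k : nat}.
Implicit Types (p f : mpoly.mpoly k K) (V : set 'rV[K]_k).

Definition peval p (z : 'rV[K]_k) : K := mpoly.meval (fun i => z 0 i) p.

Definition pdegree p : nat := (mpoly.mmeasure mpoly.mdeg p).-1.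

Definition zero_locus (I : set (mpoly.mpoly k K)) : set 'rV[K]_k :=
  [set z | forall p, I p -> peval p z = 0].

(* Not required to be irreducible. *)
Definition is_variety V : Prop := exists I, V = zero_locus I.

Definition is_hypersurface V : Prop :=
  exists f, (0 < pdegree f)%N /\ V = zero_locus [set f].

Definition vanishes_on p V : Prop := forall z, V z -> peval p z = 0.

Definition has_degree V (d : nat) : Prop :=
  (exists p, [/\ p <> 0, vanishes_on p V & pdegree p = d]) /\
  (forall p, p <> 0 -> vanishes_on p V -> (d <= pdegree p)%N).

End AlgebraicSets.

Section AlgebraicBoundary.
Context {R : realType} {k : nat}.

Definition complexify (x : 'rV[R]_k) : 'rV[R[i]]_k :=
  map_mx (fun r : R => r%:C) x.

Definition algebraic_boundary (D : set 'rV[R]_k) :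
    set 'rV[R[i]]_k :=
  smallest is_variety (complexify @` boundary D).

End AlgebraicBoundary.

Section SemidefiniteLifts.
Context {R : realType}.

Definition psd (m : nat) (A : 'M[R]_m) : Prop :=
  A^T = A /\ forall v : 'rV[R]_m, 0 <= (v *m A *m v^T) 0 0.

Definition is_spectrahedron (m n : nat) (S : set 'rV[R]_n) : Prop :=
  exists (A0 : 'M[R]_m) (A : 'I_n -> 'M[R]_m),
    [/\ A0^T = A0, (forall i, (A i)^T = A i) &
        S = [set x | psd (A0 + \sum_(i < n) x 0 i *: A i)]].

Definition has_psd_lift (k : nat) (C : set 'rV[R]_k) (m : nat) : Prop :=
  exists (n : nat) (S : set 'rV[R]_n) (pi : {linear 'rV[R]_n -> 'rV[R]_k}),
    is_spectrahedron m S /\ C = pi @` S.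

(* The rank is the relation "r is the least size of a lift", since a convex set
   need not have any lift. *)
Definition is_psd_rank (k : nat) (C : set 'rV[R]_k) (r : nat) : Prop :=
  has_psd_lift C r /\ forall m, has_psd_lift C m -> (r <= m)%N.

End SemidefiniteLifts.

(* Main.v *)
(* The degree of a hypersurface containing the boundary of the polar is at least
   the number of vertices of C: a vertex (a point whose normal cone is
   full-dimensional) is dual to a facet of the polar, hence contributes a
   hyperplane. So it suffices to find a spectrahedron of matrix size 4n with
   2^(n^2) vertices.

   In the space of (Y, S_A, S_B), with Y an n x n matrix and S_A, S_B symmetric,
   take C : S >= Q(Y) Q(Y)^T, which by Schur complement is a linear matrix
   inequality of size 2n + 2n. Here S has diagonal blocks S_A, S_B and a constant
   off-diagonal block E, and Q(Y) is linear in Y. A point with S = Q(Y) Q(Y)^T is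
   a vertex as soon as the off-diagonal block of Q(Y) Q(Y)^T has an invertible
   differential at Y. Put w_ij Y_ij in column i + j of both the i-th row of the
   upper half and the j-th row of the lower half of Q. The off-diagonal block of
   Q Q^T has entries
     sum over s of w_(i,j+s) w_(i+s,j) Y_(i,j+s) Y_(i+s,j),
   and with w_ij = eps^((n + i - j)^2) the terms with s <> 0 are negligible. So
   the equations Q_A(Y) Q_B(Y)^T = (w_ij^2) are a small perturbation of
   Y_ij^2 = 1, and have a solution near each of the 2^(n^2) sign matrices.

   That the algebraic boundary is a hypersurface holds for the boundary of any
   closed convex set with interior on which some nonzero polynomial vanishes
   (for polars of spectrahedra, by quantifier elimination): such a boundary has
   no piece of codimension two. This uses unique factorization of polynomials. *)
From HB Require Import structures.
Require Import Defs.
From mathcomp Require Import all_boot all_order all_algebra.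
From mathcomp Require Import all_classical all_reals all_analysis.
From mathcomp Require Import complex.
From mathcomp Require Import perm ring lra zify.
From mathcomp Require Import ordered_qelim qe_rcf.
From mathcomp Require mpoly.
Import (canonicals, coercions, hints) mpoly.

Set Implicit Arguments.
Unset Strict Implicit.
Unset Printing Implicit Defensive.

Import Order.TTheory GRing.Theory Num.Theory.
Import numFieldNormedType.Exports.
Local Open Scope classical_set_scope.
Local Open Scope ring_scope.

(** * Unique factorization *)

Section Factorial.
Variable A : idomainType.
Implicit Types a b c p q : A.

Definition divides a b := exists c, b = c * a.

Definition prime_elt p :=
  [/\ p != 0, p \isn't a GRing.unit &
      forall a b, divides p (a * b) -> divides p a \/ divides p b].

(** The factors are prime rather than merely irreducible, which builds uniqueness of factorization
    into the definition. *)
Inductive prime_product : A -> Prop :=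
| PrimeProductUnit u : u \is a GRing.unit -> prime_product u
| PrimeProductMul p a : prime_elt p -> prime_product a -> prime_product (p * a).

Definition factorial_ring := forall a, a != 0 -> prime_product a.

Lemma divides_mull a b c : divides a c -> divides a (b * c).
Proof. by case=> d ->; exists (b * d); rewrite mulrA. Qed.

Lemma divides_mulr a b c : divides a b -> divides a (b * c).
Proof. by move=> h; rewrite mulrC; apply: divides_mull. Qed.

Lemma prime_product_mul a b :
  prime_product a -> prime_product b -> prime_product (a * b).
Proof.
move=> Pa; elim: Pa b => {a} [u uu b|p a pp _ IH b Pb]; last first.
  by rewrite -mulrA; apply: PrimeProductMul => //; apply: IH.
move=> Pb; elim: Pb u uu => {b} [v uv u uu|p a pp _ IH u uu].
  by apply: PrimeProductUnit; rewrite unitrM uu uv.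
by rewrite mulrCA; apply: PrimeProductMul => //; apply: IH.
Qed.

Lemma prime_mul_unit p a b : prime_elt p -> p = a * b ->
  a \is a GRing.unit \/ b \is a GRing.unit.
Proof.
move=> [p0 _ pP] E; have /pP : divides p (a * b) by exists 1; rewrite mul1r.
have aux x y : p = x * y -> divides p x -> y \is a GRing.unit.
  move=> Exy [z Ez]; apply/unitrP; exists z.
  have h : z * y = 1; last by rewrite h mulrC h.
  by apply: (mulIf p0); rewrite mul1r {2}Exy Ez mulrAC.
case=> [h|h]; [right; apply: aux E h|left; apply: aux h].
by rewrite mulrC.
Qed.

End Factorial.

Arguments prime_elt {A}.
Arguments prime_product {A}.
Arguments divides {A}.

Section FactorialPoly.
Variable A : idomainType.
Implicit Types (a b c p : A) (f g h : {poly A}).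

Lemma divides_polyC p f : divides p%:P f <-> forall i, divides p f`_i.
Proof.
split=> [[g -> i]|h]; first by exists g`_i; rewrite coefMC.
have [c cP] := boolp.choice h.
exists (\poly_(i < size f) c i); apply/polyP => i; rewrite coefMC coef_poly.
case: ltnP => // /(nth_default 0) ->; by rewrite mul0r.
Qed.

(** Gauss's lemma. With [i], [j] the least indices of coefficients of [f], [g] not divisible by [p],
    every other term of coefficient [i + j] of [f * g] is divisible by [p]. *)
Lemma prime_eltC p : prime_elt p -> prime_elt p%:P.
Proof.
move=> [p0 pu pP]; split; first by rewrite polyC_eq0.
  by rewrite poly_unitE size_polyC p0 /= coefC eqxx.
move=> f g pfg; apply: contrapT => /not_orP[nf ng].
have exP h : ~ divides p%:P h -> exists i, `[< ~ divides p h`_i >].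
  move=> nh; apply: contrapT => nex; apply: nh; apply/divides_polyC => i.
  by apply: contrapT => ni; apply: nex; exists i; apply/asboolP.
case: (ex_minnP (exP _ nf)) => i /asboolP fi mini.
case: (ex_minnP (exP _ ng)) => j /asboolP gj minj.
have /divides_polyC/(_ (i + j)%N) := pfg; rewrite coefM.
have li : (i < (i + j).+1)%N by rewrite ltnS leq_addr.
rewrite (bigD1 (Ordinal li)) //= addKn => -[c Ec].
have [d Ed] : divides p (\sum_(k < (i + j).+1 | k != Ordinal li)
     f`_k * g`_(i + j - k)).
  elim/big_ind: _ => [|x y [c1 ->] [c2 ->]|k ki].
  - by exists 0; rewrite mul0r.
  - by exists (c1 + c2); rewrite mulrDl.
  have {}ki : nat_of_ord k != i by apply: contraNneq ki => e; apply/eqP/val_inj.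
  have [lt|gt|eki] := ltngtP k i; last by rewrite eki eqxx in ki.
    apply: divides_mulr; apply: contrapT => n.
    have /mini : `[< ~ divides p f`_k >] by apply/asboolP.
    by rewrite leqNgt lt.
  apply: divides_mull; apply: contrapT => n.
  have /minj : `[< ~ divides p g`_(i + j - k) >] by apply/asboolP.
  by have := ltn_ord k; lia.
have /pP[] // : divides p (f`_i * g`_j).
by exists (c - d); rewrite mulrBl -Ec Ed addrK.
Qed.

(** By Gauss's lemma each prime of [c] divides [q] or [d] and can be cancelled there. This turns a
    factorization over the fraction field into one over [A]. *)
Lemma prime_product_split c f q d : prime_product c -> c%:P * f = q * d ->
  exists q' d' a b, [/\ f = q' * d', q = a%:P * q' & d = b%:P * d'].
Proof.
move=> Pc; elim: Pc f q d => {c} [u uu f q d E|p c pp _ IH f q d].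
  exists (u^-1%:P * q), d, u, 1; rewrite mul1r mulrA -polyCM divrr // mul1r.
  by split => //; rewrite -mulrA -E mulrA -polyCM mulVr // mul1r.
rewrite polyCM -mulrA => E; have [p0 _ pP] := prime_eltC pp.
have : divides p%:P (q * d) by exists (c%:P * f); rewrite -E mulrC.
case/pP => -[g Eg].
  have /IH[q' [d' [a [b [-> Eq ->]]]]] : c%:P * f = g * d.
    by apply: (mulfI p0); rewrite E Eg; ring.
  by exists q', d', (a * p), b; rewrite Eg Eq polyCM mulrAC.
have /IH[q' [d' [a [b [-> -> Ed]]]]] : c%:P * f = q * g.
  by apply: (mulfI p0); rewrite E Eg; ring.
by exists q', d', a, (b * p); rewrite Eg Ed polyCM mulrAC.
Qed.

(** Primitivity, phrased without a gcd of the coefficients. *)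
Definition no_prime_constant f :=
  forall p, prime_elt p -> ~ divides p%:P f.

Lemma divides_cancelC f g c : no_prime_constant f -> prime_product c ->
  divides f (c%:P * g) -> divides f g.
Proof.
move=> nf Pc; elim: Pc g => {c} [u uu g [w E]|p c pp _ IH g].
  exists (u^-1%:P * w).
  by rewrite -mulrA -E mulrA -polyCM mulVr // mul1r.
rewrite polyCM -mulrA => -[w E]; have [p0 _ pP] := prime_eltC pp.
have : divides p%:P (w * f) by exists (c%:P * g); rewrite -E mulrC.
case/pP => [[g1 Eg]|pf]; last by case: (nf p pp).
by apply: IH; exists g1; apply: (mulfI p0); rewrite E Eg; ring.
Qed.

(* Bezout with a constant: if gcd(f, g) over the fraction field is nonconstant,
   clearing denominators and removing prime constants shows f | g. *)
Lemma divides_or_bezout f g : factorial_ring A ->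
  (1 < size f)%N -> no_prime_constant f ->
  (forall g h, f = g * h -> (size g <= 1)%N \/ (size h <= 1)%N) ->
  divides f g \/ exists u v c, c != 0 /\ u * f + v * g = c%:P.
Proof.
move=> fA sf nf irf; set d := gcdp f g.
have f0 : f != 0 by rewrite -size_poly_gt0; lia.
have d0 : d != 0 by rewrite gcdp_eq0 (negPf f0).
have [cop|ncop] := boolP (coprimep f g).
  right; have /Pdiv.Idomain.Bezout_coprimepP[[u v] /= E] := cop.
  have /eqp_size := E; rewrite size_poly1 => sE.
  have /size1_polyC Ec : (size (u * f + v * g)%R <= 1)%N by rewrite sE.
  exists u, v, (u * f + v * g)`_0; split=> //.
  by apply/eqP => c0; move: sE; rewrite Ec c0 size_poly0.
left.
have /Pdiv.Idomain.dvdpP[[c q] /= c0 Ef] : d %| f by apply: dvdp_gcdl.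
have /Pdiv.Idomain.dvdpP[[c' q2] /= c'0 Eg] : d %| g by apply: dvdp_gcdr.
rewrite -mul_polyC in Ef; rewrite -mul_polyC in Eg.
have [q' [d' [a [b [Ef' Eq Ed]]]]] := prime_product_split (fA _ c0) Ef.
have b0 : b != 0 by apply: contraNneq d0 => b0; rewrite Ed b0 mul0r.
have sd : (1 < size d')%N.
  move: ncop; rewrite /coprimep -/d Ed mul_polyC size_scale //.
  have : d' != 0 by apply: contraNneq d0; rewrite Ed => ->; rewrite mulr0.
  by rewrite -size_poly_gt0; case: (size d') => [|[]].
case: (irf _ _ Ef') => [/size1_polyC Eq'|]; last by rewrite leqNgt sd.
have e0 : q'`_0 != 0.
  by apply: contraNneq f0 => e0; rewrite Ef' Eq' e0 mul0r.
apply: (@divides_cancelC _ _ (q'`_0 * c')) => //.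
  by apply: fA; rewrite mulf_neq0.
exists (q2 * b%:P); rewrite polyCM -mulrA Eg Ef' Ed {2}Eq'; ring.
Qed.

(** Induction on the primes of a constant [a] that all constant divisors of [f] divide, at first the
    leading coefficient. A prime of [a] is either extracted from [f] or, if it does not divide [f],
    dropped from [a]. *)
Lemma primitive_part f : factorial_ring A -> f != 0 ->
  exists c g, [/\ c != 0, f = c%:P * g & no_prime_constant g].
Proof.
move=> fA f0.
suff H a : prime_product a -> forall f, f != 0 ->
    (forall c, divides c%:P f -> divides c a) ->
    exists c g, [/\ c != 0, f = c%:P * g & no_prime_constant g].
  apply: (H (lead_coef f) _ f f0); first by apply: fA; rewrite lead_coef_eq0.
  by move=> c /divides_polyC; apply.
elim=> {a f f0} [u uu f f0 H|p a pp Pa IH f f0 H].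
  exists 1, f; split; rewrite ?mul1r ?oner_eq0 // => p [_ pu _] /H[c E].
  by move: uu; rewrite E unitrM (negPf pu) andbF.
have [p0 _ pP] := pp.
have [[g Eg]|nd] := pselect (divides p%:P f).
  have g0 : g != 0 by apply: contraNneq f0; rewrite Eg => ->; rewrite mul0r.
  have [|c [h [c0 Eh nh]]] := IH g g0.
    move=> c [h Eh]; have [|e Ee] := H (c * p).
      by exists h; rewrite Eg Eh polyCM mulrA.
    by exists e; apply: (mulfI p0); rewrite Ee; ring.
  exists (p * c), h; split => //; first by rewrite mulf_neq0.
  by rewrite Eg Eh polyCM; ring.
apply: IH => // c cf; have [e Ee] := H _ cf.
have /pP[] : divides p (e * c) by rewrite -Ee; exists a; rewrite mulrC.
  by case=> e' Ee'; exists e'; apply: (mulfI p0); rewrite Ee Ee'; ring.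
case=> c' Ec; case: nd; have [g ->] := cf; rewrite Ec polyCM.
by exists (g * c'%:P); rewrite mulrA.
Qed.

Lemma prime_productC c : prime_product c -> prime_product c%:P.
Proof.
elim=> [u uu|p a pp _ IH]; last first.
  by rewrite polyCM; apply: PrimeProductMul => //; apply: prime_eltC.
apply: PrimeProductUnit; rewrite poly_unitE coefC eqxx uu andbT size_polyC.
by have -> : u != 0 by apply: contraTneq uu => ->; rewrite unitr0.
Qed.

(** Gauss's theorem, by induction on the degree: after removal of the content, a polynomial either
    splits into factors of smaller degree or is prime by the Bezout alternative. *)
Theorem factorial_poly : factorial_ring A -> factorial_ring {poly A}.
Proof.
move=> fA f; have [n] := ubnP (size f); elim: n f => // n IH f sf f0.
have [c [g [c0 Ef ng]]] := primitive_part fA f0.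
rewrite Ef; apply: prime_product_mul; first exact/prime_productC/fA.
have g0 : g != 0 by apply: contraNneq f0; rewrite Ef => ->; rewrite mulr0.
have {}sf : (size g < n.+1)%N by rewrite Ef mul_polyC size_scale in sf.
have [/size1_polyC Eg|sg] := leqP (size g) 1.
  rewrite Eg; apply/prime_productC/fA.
  by rewrite -polyC_eq0 -Eg.
have [[h1 [h2 [E s1 s2]]]|irr] := pselect
  (exists h1 h2, [/\ g = h1 * h2, (1 < size h1)%N & (1 < size h2)%N]).
  have h10 : h1 != 0 by rewrite -size_poly_gt0; lia.
  have h20 : h2 != 0 by rewrite -size_poly_gt0; lia.
  rewrite E size_mul // in sf; rewrite E.
  by apply: prime_product_mul; apply: IH => //; lia.
have irg h1 h2 : g = h1 * h2 -> (size h1 <= 1)%N \/ (size h2 <= 1)%N.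
  move=> E; have [s1|s1] := leqP (size h1) 1; first by left.
  have [s2|s2] := leqP (size h2) 1; first by right.
  by case: irr; exists h1, h2.
rewrite -[g]mulr1; apply: PrimeProductMul; last first.
  by apply: PrimeProductUnit; rewrite unitr1.
split=> //; first by rewrite poly_unitE gtn_eqF.
(* If [g] divides [a * b] but not [a], multiplying the Bezout identity by [b] shows that [g] divides
   [e%:P * b]; as [g] is primitive, the constant [e] cancels. *)
move=> a b [w Ew].
have [|[u [v [e [e0 E]]]]] := divides_or_bezout a fA sg ng irg; first by left.
right; apply: (divides_cancelC ng (fA _ e0)).
by exists (u * b + v * w); rewrite -E !mulrDl -[v * a * b]mulrA Ew; ring.
Qed.

(** A nonconstant prime is primitive and has no splitting into two nonconstant factors, since one
    factor would be a unit. A constant prime is itself the Bezout constant. *)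
Lemma prime_divides_or_bezout f g : factorial_ring A -> prime_elt f ->
  divides f g \/ exists u v c, c != 0 /\ u * f + v * g = c%:P.
Proof.
move=> fA pf; have [f0 fu fP] := pf.
have [/size1_polyC Ef|sf] := leqP (size f) 1.
  right; exists 1, 0, f`_0; rewrite mul0r addr0 mul1r; split=> //.
  by rewrite -polyC_eq0 -Ef.
have unit1 h : h \is a GRing.unit -> (size h <= 1)%N.
  by rewrite poly_unitE => /andP[/eqP ->].
apply: divides_or_bezout => // [p pp [h E]|g1 h1 /(prime_mul_unit pf)].
  case: (prime_mul_unit pf E) => [hu|].
    have := unit1 _ hu => /size1_polyC Eh.
    by move: sf; rewrite E Eh -polyCM size_polyC; case: eqP.
  by case: (prime_eltC pp) => _ /negP.
by case=> /unit1; [left|right].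
Qed.

End FactorialPoly.

Lemma prime_elt_iso (A B : idomainType) (phi : {rmorphism A -> B})
  (psi : {rmorphism B -> A}) (p : A) :
  cancel phi psi -> cancel psi phi -> prime_elt (phi p) -> prime_elt p.
Proof.
move=> K K' [p0 pu pP]; split.
- by apply: contraNneq p0 => ->; rewrite rmorph0.
- by apply: contraNN pu => /(rmorph_unit phi).
move=> a b [c E]; have /pP[] : divides (phi p) (phi a * phi b).
- by exists (phi c); rewrite -!rmorphM E.
- by case=> d Ed; left; exists (psi d); rewrite -[a]K Ed rmorphM K.
by case=> d Ed; right; exists (psi d); rewrite -[b]K Ed rmorphM K.
Qed.

Lemma factorial_iso (A B : idomainType) (phi : {rmorphism A -> B})
  (psi : {rmorphism B -> A}) :
  cancel phi psi -> cancel psi phi -> factorial_ring B -> factorial_ring A.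
Proof.
move=> K K' fB a a0.
have /fB : phi a != 0.
  by apply: contraNneq a0 => E; rewrite -[a]K E rmorph0.
rewrite -{2}[a]K; elim=> {a a0} [u uu|p b pp _ IH].
  by apply: PrimeProductUnit; apply: rmorph_unit.
rewrite rmorphM; apply: PrimeProductMul => //.
by apply: (prime_elt_iso K K'); rewrite K'.
Qed.

Section Substitution.
Variables (n : nat) (K : idomainType).
Implicit Types (p q : mpoly.mpoly n K) (v : 'I_n -> K).

Lemma mpoly_rmorphism_ext (B : comNzRingType)
    (f g : {rmorphism mpoly.mpoly n K -> B}) :
  (forall c, f (mpoly.mpolyC n c) = g (mpoly.mpolyC n c)) ->
  (forall i, f (mpoly.mpolyX K (mpoly.mnm1 i)) =
             g (mpoly.mpolyX K (mpoly.mnm1 i))) -> f =1 g.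
Proof.
move=> EC EX p; rewrite (mpoly.mpolyE p) !rmorph_sum; apply: eq_bigr => m _.
rewrite -mpoly.mul_mpolyC !rmorphM EC; congr (_ * _).
rewrite (mpoly.mpolyXE_id K m) !rmorph_prod; apply: eq_bigr => i _.
by rewrite !rmorphXn EX.
Qed.

Definition mline (a b : 'I_n -> K) p : {poly K} :=
  mpoly.mmap polyC (fun i => (a i)%:P + b i *: 'X) p.

Lemma horner_mline a b p t :
  (mline a b p).[t] = mpoly.meval (fun i => a i + b i * t) p.
Proof.
rewrite /mline /mpoly.mmap horner_sum mpoly.mevalE; apply: eq_bigr => m _.
rewrite hornerM hornerC; congr (_ * _).
rewrite /mpoly.mmap1 horner_prod; apply: eq_bigr => i _.
by rewrite horner_exp hornerD hornerZ hornerX hornerC.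
Qed.

Lemma size_mline a b p : (size (mline a b p) <= mpoly.mmeasure mpoly.mdeg p)%N.
Proof.
rewrite /mline /mpoly.mmap; apply: (leq_trans (size_sum _ _ _)).
have aux (x y z : nat) : (x <= 1)%N -> (y <= z.+1)%N -> ((x + y).-1 <= z.+1)%N.
  by lia.
apply/bigmax_leqP_seq => m mp _.
apply: (leq_trans (size_polyMleq _ _)).
apply: leq_trans (mpoly.msize_mdeg_lt mp).
suff : (size (mpoly.mmap1 (fun i => (a i)%:P + b i *: 'X)%R m) <=
        (mpoly.mdeg m).+1)%N.
  by apply: aux; apply: size_polyC_leq1.
rewrite /mpoly.mmap1 mpoly.mdegE.
elim/big_ind2: _ => [|x1 x2 y1 y2 h1 h2|i _].
- by rewrite size_poly1.
- by apply: (leq_trans (size_polyMleq _ _)); move: h1 h2; case: (size x1) => [|k]; lia.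
apply: (leq_trans (size_poly_exp_leq _ _)).
have : (size ((a i)%:P + b i *: 'X)%R <= 2)%N.
  apply: (leq_trans (size_polyD _ _)); rewrite geq_max.
  apply/andP; split; first by have := size_polyC_leq1 (a i); lia.
  by apply: (leq_trans (size_scale_leq _ _)); rewrite size_polyX.
case: (size _) => [|[|[]]] //= _; lia.
Qed.

End Substitution.

(** * Multivariate polynomials as univariate polynomials in the last variable *)

Section Uncurry.
Variables (n : nat) (K : idomainType).
Notation widen := (widen_ord (leqnSn n)).

Definition muncurry : {poly mpoly.mpoly n K} -> mpoly.mpoly n.+1 K :=
  horner_eval (mpoly.mpolyX K (mpoly.mnm1 ord_max)) \o map_poly (@mpoly.mwiden n K).

HB.instance Definition _ := GRing.RMorphism.on muncurry.

Lemma meval_muncurry (v : 'I_n.+1 -> K) q :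
  mpoly.meval v (muncurry q) =
  (map_poly (mpoly.meval (v \o widen)) q).[v ord_max].
Proof.
elim/poly_ind: q => [|q c IH]; first by rewrite !rmorph0 horner0.
rewrite rmorphD rmorphM /= [in RHS]rmorphD [in RHS]rmorphM /= map_polyX map_polyC.
rewrite mpoly.mevalD mpoly.mevalM IH hornerD hornerMX hornerC.
rewrite /muncurry /= map_polyX map_polyC /= /horner_eval hornerX hornerC.
rewrite mpoly.mevalXU; congr (_ + _).
rewrite /mpoly.mwiden /mpoly.mmap [RHS]mpoly.mevalE rmorph_sum.
apply: eq_bigr => m _; rewrite /= mpoly.mevalM mpoly.mevalC; congr (_ * _).
rewrite /mpoly.mmap1 rmorph_prod; apply: eq_bigr => i _.
by rewrite rmorphXn /= mpoly.mevalXU.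
Qed.

Lemma muni_varE i : mpoly.muni (mpoly.mpolyX K (mpoly.mnm1 (widen i))) =
  (mpoly.mpolyX K (mpoly.mnm1 i))%:P.
Proof.
rewrite /mpoly.muni mpoly.mmapX mpoly.mmap1U; case: splitP => [j /= eq|j /=].
  by congr (mpoly.mpolyX K (mpoly.mnm1 _))%:P; apply/val_inj.
by rewrite ord1 addn0 => e; have := ltn_ord i; rewrite e ltnn.
Qed.

Lemma muni_var_max : @mpoly.muni n K (mpoly.mpolyX K (mpoly.mnm1 ord_max)) = 'X.
Proof.
rewrite /mpoly.muni mpoly.mmapX mpoly.mmap1U; case: splitP => // j /= e.
by have := ltn_ord j; rewrite -e ltnn.
Qed.

Lemma muncurryD : {morph muncurry : p q / p + q}. Proof. exact: rmorphD. Qed.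

Lemma muncurryM : {morph muncurry : p q / p * q}. Proof. exact: rmorphM. Qed.

Lemma muncurryX : muncurry 'X = mpoly.mpolyX K (mpoly.mnm1 ord_max).
Proof. by rewrite /muncurry /= map_polyX /horner_eval hornerX. Qed.

Lemma muncurryC c : muncurry c%:P = mpoly.mwiden c.
Proof. by rewrite /muncurry /= map_polyC /horner_eval hornerC. Qed.

Lemma mwiden_var i : mpoly.mwiden (mpoly.mpolyX K (mpoly.mnm1 i)) =
  mpoly.mpolyX K (mpoly.mnm1 (widen i)).
Proof. by rewrite /mpoly.mwiden mpoly.mmapX mpoly.mmap1U. Qed.

Lemma muniK : cancel (@mpoly.muni n K) muncurry.
Proof.
apply: (@mpoly_rmorphism_ext _ _ _ (muncurry \o @mpoly.muni n K) idfun).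
  by move=> c /=; rewrite mpoly.muniC muncurryC mpoly.mwidenC.
move=> i /=; case: (unliftP ord_max i) => [j ->|->].
  have -> : lift ord_max j = widen j.
    by apply/val_inj; rewrite /= /bump leqNgt ltn_ord.
  by rewrite muni_varE muncurryC mwiden_var.
by rewrite muni_var_max muncurryX.
Qed.

Lemma muni_mwiden : @mpoly.muni n K \o @mpoly.mwiden n K =1 polyC.
Proof.
apply: (@mpoly_rmorphism_ext _ _ _ (@mpoly.muni n K \o @mpoly.mwiden n K) polyC).
  by move=> c /=; rewrite mpoly.mwidenC mpoly.muniC.
by move=> i /=; rewrite mwiden_var muni_varE.
Qed.

Lemma muncurryK : cancel muncurry (@mpoly.muni n K).
Proof.
move=> q; elim/poly_ind: q => [|q c IH]; first by rewrite !rmorph0.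
rewrite !rmorphD !rmorphM /= IH muncurryX muni_var_max muncurryC.
by congr (_ + _); apply: muni_mwiden.
Qed.

End Uncurry.

Lemma factorial_mpoly n (K : fieldType) : factorial_ring (mpoly.mpoly n K).
Proof.
elim: n => [|n IH]; last first.
  exact: (factorial_iso (@muniK n K) (@muncurryK n K)) (factorial_poly IH).
move=> p p0; apply: PrimeProductUnit; rewrite (mpoly.nvar0_mpolyC p) in p0 *.
by rewrite rmorph_unit // unitfE -(mpoly.mpolyC_eq0 0).
Qed.

Lemma meval_msym n (K : idomainType) (s : 'S_n) (v : 'I_n -> K) p :
  mpoly.meval v (mpoly.msym s p) = mpoly.meval (v \o s) p.
Proof.
rewrite /mpoly.msym /mpoly.mmap rmorph_sum [RHS]mpoly.mevalE.
apply: eq_bigr => m _; rewrite /= mpoly.mevalM mpoly.mevalC; congr (_ * _).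
rewrite /mpoly.mmap1 rmorph_prod; apply: eq_bigr => i _.
by rewrite rmorphXn /= mpoly.mevalXU.
Qed.

(** [r] plays the role of a resultant: it is the Bezout constant of [p] and [q] viewed as
    polynomials in the last variable, so it is free of that variable. *)
Lemma eliminate_last n (K : fieldType) (p q : mpoly.mpoly n.+1 K) :
  prime_elt p -> ~ divides p q ->
  exists a b r, [/\ r != 0, a * p + b * q = r &
    forall v v' : 'I_n.+1 -> K, (forall j, j != ord_max -> v j = v' j) ->
      mpoly.meval v r = mpoly.meval v' r].
Proof.
move=> pp npq.
have pp' : prime_elt (mpoly.muni p).
  by apply: (prime_elt_iso (@muncurryK n K) (@muniK n K)); move: pp; rewrite -{1}(muniK p).
case: (prime_divides_or_bezout (mpoly.muni q) (@factorial_mpoly n K) pp').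
  case=> c E; case: npq; exists (muncurry c).
  by rewrite -[q]muniK E rmorphM /= muniK.
case=> u [v [c [c0 E]]]; exists (muncurry u), (muncurry v), (mpoly.mwiden c).
rewrite -muncurryC; split.
- by rewrite (can2_eq (@muncurryK n K) (@muniK n K)) rmorph0 polyC_eq0.
- have -> : muncurry c%:P = muncurry (u * mpoly.muni p + v * mpoly.muni q).
    by rewrite E.
  rewrite muncurryD; congr (_ + _).
    by rewrite muncurryM; congr (_ * _); rewrite muniK.
  by rewrite muncurryM; congr (_ * _); rewrite muniK.
move=> w w' ww'; rewrite !meval_muncurry !map_polyC !hornerC.
apply: mpoly.meval_eq => i /=; apply: ww'.
by rewrite -val_eqE /= ltn_eqF.
Qed.

Lemma eliminate_var n (K : fieldType) (p q : mpoly.mpoly n K) (i : 'I_n) :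
  prime_elt p -> ~ divides p q ->
  exists a b r, [/\ r != 0, a * p + b * q = r &
    forall v v' : 'I_n -> K, (forall j, j != i -> v j = v' j) ->
      mpoly.meval v r = mpoly.meval v' r].
Proof.
case: n p q i => [? ? []//|n] p q i pp npq.
(* Exchanging variable [i] with the last one reduces the claim to [eliminate_last]. *)
pose s : 'S_n.+1 := tperm i ord_max.
have K1 : cancel (mpoly.msym s : mpoly.mpoly n.+1 K -> _) (mpoly.msym s).
  by move=> f; rewrite -mpoly.msymMm tperm2 mpoly.msym1m.
have pp' : prime_elt (mpoly.msym s p).
  by apply: (prime_elt_iso K1 K1); move: pp; rewrite -{1}(K1 p).
have [|a [b [r [r0 E H]]]] := eliminate_last pp' (q := mpoly.msym s q).
  by case=> c E; apply: npq; exists (mpoly.msym s c); rewrite -[q]K1 E mpoly.msymM K1.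
exists (mpoly.msym s a), (mpoly.msym s b), (mpoly.msym s r); split.
- by rewrite (can2_eq K1 K1) mpoly.msym0.
- by rewrite -E mpoly.msymD !mpoly.msymM !K1.
move=> v v' vv'; rewrite !meval_msym; apply: H => j jm /=; apply: vv'.
by apply: contraNneq jm => e; rewrite -(tpermK i ord_max j) -/s e tpermL.
Qed.

(** Induction on the leading coefficient in the last variable, then finiteness of the roots in that
    variable. Coordinates from an injective sequence allow complex polynomials to be tested at real
    points. *)
Lemma exists_meval_neq0 n (K : fieldType) (f : nat -> K) (p : mpoly.mpoly n K) :
  injective f -> p != 0 -> exists w : 'I_n -> nat, mpoly.meval (f \o w) p != 0.
Proof.
move=> finj; elim: n p => [|n IH] p p0.
  exists (fun=> 0%N); rewrite (mpoly.nvar0_mpolyC p) in p0 *.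
  by rewrite mpoly.mevalC -(mpoly.mpolyC_eq0 0).
have : lead_coef (mpoly.muni p) != 0.
  by rewrite lead_coef_eq0 (can2_eq (@muniK n K) (@muncurryK n K)) rmorph0.
case/IH => w' w'0.
set P := map_poly (mpoly.meval (f \o w')) (mpoly.muni p).
have P0 : P != 0.
  apply: contraNneq w'0 => E; rewrite lead_coefE.
  by have := congr1 (coefp (size (mpoly.muni p)).-1) E; rewrite /= coef0 coef_map /= => ->.
have [k Pk] : exists k, P.[f k] != 0.
  apply: contrapT => h.
  have : all (root P) (map f (iota 0 (size P))).
    apply/allP => x /mapP[k _ ->]; apply/contraT => hk.
    by case: h; exists k.
  move=> /(max_poly_roots P0); rewrite map_inj_uniq // iota_uniq.
  by rewrite size_map size_iota ltnn => /(_ isT).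
exists (fun i => if unlift ord_max i is Some j then w' j else k).
rewrite -[p]muniK meval_muncurry /= unlift_none.
rewrite (_ : map_poly _ _ = P) //; apply: eq_map_poly => c /=.
apply: mpoly.meval_eq => i /=.
have -> : widen_ord (leqnSn n) i = lift ord_max i.
  by apply/val_inj; rewrite /= /bump leqNgt ltn_ord.
by rewrite liftK.
Qed.

(** * Polynomials on real points *)

Section RealPoints.
Variables (R : realType) (k : nat).
Implicit Types (p q : mpoly.mpoly k R[i]) (x y d : 'rV[R]_k).
Local Open Scope complex_scope.

Lemma poly_eq0_interval (q : {poly R[i]}) (e : R) : 0 < e ->
  (forall t, 0 < t < e -> q.[t%:C] = 0) -> q = 0.
Proof.
move=> e0 H; apply/eqP/contraT => q0.
(* More roots than the degree allows; the denominator starts at 2 to stay strictly below [e]. *)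
pose s := map (fun j : nat => (e / j.+2%:R)%:C) (iota 0 (size q)).
have : all (root q) s.
  apply/allP => x /mapP[j _ ->]; apply/eqP/H.
  rewrite divr_gt0 ?ltr0n //= ltr_pdivrMr ?ltr0n //.
  by rewrite -[ltLHS]mulr1 ltr_pM2l // ltr1n.
move=> /(max_poly_roots q0); rewrite map_inj_in_uniq ?iota_uniq.
  by rewrite size_map size_iota ltnn => /(_ isT).
move=> i j _ _ /complexI/(mulfI (lt0r_neq0 e0))/invr_inj/eqP.
by rewrite eqr_nat => /eqP[].
Qed.

Lemma peval_line p x d (t : R) :
  peval p (complexify (x + t *: d)) =
  (mline (fun i => (x 0 i)%:C) (fun i => (d 0 i)%:C) p).[t%:C].
Proof.
rewrite horner_mline; apply: mpoly.meval_eq => i.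
by rewrite !mxE rmorphD rmorphM /= mulrC.
Qed.

(** Vanishing on an initial piece of a ray forces vanishing on the whole line, and every point, in
    particular one where a nonzero [p] would not vanish, is on a line through [x]. *)
Lemma mpoly_eq0_core p x :
  (forall d, exists2 e : R, 0 < e &
     forall t, 0 < t < e -> peval p (complexify (x + t *: d)) = 0) ->
  p = 0.
Proof.
move=> H; apply/eqP/contraT => p0.
have finj : injective (fun n : nat => n%:R : R[i]).
  by move=> m n /eqP; rewrite eqr_nat => /eqP.
have [w /eqP[]] := exists_meval_neq0 finj p0.
pose y : 'rV[R]_k := \row_i (w i)%:R.
have [e e0 He] := H (y - x).
transitivity (peval p (complexify (x + 1 *: (y - x)))).
  apply: mpoly.meval_eq => i /=; rewrite scale1r addrC subrK !mxE.
  by rewrite rmorph_nat.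
rewrite peval_line; set q := mline _ _ _.
suff -> : q = 0 by rewrite horner0.
by apply: (poly_eq0_interval e0) => t te; rewrite -peval_line He.
Qed.

Lemma mpoly_eq0_ball p x (e : R) : 0 < e ->
  (forall y, ball x e y -> peval p (complexify y) = 0) -> p = 0.
Proof.
move=> e0 H; apply: (@mpoly_eq0_core _ x) => d.
exists (e / (`|d| + 1)); first by rewrite divr_gt0 // ltr_wpDl.
move=> t /andP[t0 te]; apply: H; rewrite -ball_normE /ball_ /=.
rewrite opprD addNKr normrN normrZ gtr0_norm //.
have : t * (`|d| + 1) < e by rewrite -ltr_pdivlMr // ltr_wpDl.
apply: le_lt_trans; by rewrite ler_wpM2l ?lerDl // ltW.
Qed.

Let ccont (F : 'rV[R]_k -> R[i]) :=
  continuous (fun x => complex.Re (F x)) /\ continuous (fun x => complex.Im (F x)).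

Lemma peval_continuous p :
  continuous (fun x => complex.Re (peval p (complexify x))) /\
  continuous (fun x => complex.Im (peval p (complexify x))).
Proof.
have cst c : ccont (fun=> c) by split => x; apply: cst_continuous.
have add F G : ccont F -> ccont G -> ccont (fun x => F x + G x).
  move=> [F1 F2] [G1 G2]; split => x.
    have -> : (fun x => complex.Re (F x + G x)) = (fun x => complex.Re (F x) + complex.Re (G x)).
      by apply/funext => y; rewrite raddfD.
    exact: continuousD (F1 x) (G1 x).
  have -> : (fun x => complex.Im (F x + G x)) = (fun x => complex.Im (F x) + complex.Im (G x)).
    by apply/funext => y; rewrite raddfD.
  exact: continuousD (F2 x) (G2 x).
have cmul F G : ccont F -> ccont G -> ccont (fun x => F x * G x).
  move=> [F1 F2] [G1 G2]; split => x.
    have -> : (fun x => complex.Re (F x * G x)) =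
        (fun x => complex.Re (F x) * complex.Re (G x) - complex.Im (F x) * complex.Im (G x)).
      by apply/funext => y; case: (F y) => a b; case: (G y).
    exact: continuousB (continuousM (F1 x) (G1 x)) (continuousM (F2 x) (G2 x)).
  have -> : (fun x => complex.Im (F x * G x)) =
      (fun x => complex.Re (F x) * complex.Im (G x) + complex.Im (F x) * complex.Re (G x)).
    by apply/funext => y; case: (F y) => a b; case: (G y).
  exact: continuousD (continuousM (F1 x) (G2 x)) (continuousM (F2 x) (G1 x)).
have coord i : ccont (fun x => (complexify x) 0 i).
  split => x.
    have -> : (fun x => complex.Re ((complexify x) 0 i)) = (fun x : 'rV[R]_k => x 0 i).
      by apply/funext => y; rewrite mxE.
    exact: coord_continuous.
  have -> : (fun x => complex.Im ((complexify x) 0 i)) = (fun x : 'rV[R]_k => 0).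
    by apply/funext => y; rewrite mxE.
  exact: cst_continuous.
have exp F n : ccont F -> ccont (fun x => F x ^+ n).
  move=> cF; elim: n => [|n IH]; first exact: cst.
  have -> : (fun x => F x ^+ n.+1) = (fun x => F x * F x ^+ n).
    by apply/funext => y; rewrite exprS.
  exact: cmul.
suff : ccont (fun x => peval p (complexify x)) by [].
have -> : (fun x => peval p (complexify x)) = (fun x => \sum_(m <- mpoly.msupp p)
    mpoly.mcoeff m p * \prod_i (complexify x) 0 i ^+ mpoly.fun_of_multinom m i).
  by apply/funext => x; rewrite /peval mpoly.mevalE.
elim: (mpoly.msupp p) => [|m s IH].
  have -> : (fun x => \sum_(m <- [::])
    mpoly.mcoeff m p * \prod_i (complexify x) 0 i ^+ mpoly.fun_of_multinom m i)
    = (fun=> 0) by apply/funext => x; rewrite big_nil.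
  exact: cst.
have -> : (fun x => \sum_(m <- m :: s)
    mpoly.mcoeff m p * \prod_i (complexify x) 0 i ^+ mpoly.fun_of_multinom m i)
    = (fun x => mpoly.mcoeff m p *
        \prod_i (complexify x) 0 i ^+ mpoly.fun_of_multinom m i +
     \sum_(m <- s)
    mpoly.mcoeff m p * \prod_i (complexify x) 0 i ^+ mpoly.fun_of_multinom m i).
  by apply/funext => x; rewrite big_cons.
apply: (add) IH; apply: (cmul); first exact: cst.
elim: (index_enum 'I_k) => [|i r IH].
  have -> : (fun x => \prod_(i <- [::])
     (complexify x) 0 i ^+ mpoly.fun_of_multinom m i)
    = (fun=> 1) by apply/funext => x; rewrite big_nil.
  exact: cst.
have -> : (fun x => \prod_(i <- i :: r)
     (complexify x) 0 i ^+ mpoly.fun_of_multinom m i) =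
   (fun x => (complexify x) 0 i ^+ mpoly.fun_of_multinom m i *
     \prod_(i <- r) (complexify x) 0 i ^+ mpoly.fun_of_multinom m i).
  by apply/funext => x; rewrite big_cons.
by apply: (cmul) IH; apply: (exp).
Qed.

Lemma peval_neq0_ball p x : peval p (complexify x) != 0 ->
  exists2 e : R, 0 < e &
    forall y, ball x e y -> peval p (complexify y) != 0.
Proof.
have [cR cI] := peval_continuous p.
rewrite eq_complex negb_and => nz.
suff H (f : 'rV[R]_k -> R) : continuous f -> f x != 0 ->
    exists2 e : R, 0 < e & forall y, ball x e y -> f y != 0.
  by case/orP: nz => [/(H _ cR)|/(H _ cI)][e e0 He]; exists e => // y /He h;
    rewrite eq_complex negb_and h ?orbT.
move=> cf fx; have /nbhs_ballP[e e0 He] : nbhs x [set y | f y != 0].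
  by apply: (cf x [set z | z != 0]); apply: open_nbhs_nbhs; split => //; apply: open_neq.
by exists e.
Qed.

End RealPoints.

(** * Algebraic boundaries of convex sets *)

Section Convex.
Variables (R : realType) (k : nat).
Implicit Types (K : set 'rV[R]_k) (x y z d : 'rV[R]_k).

Definition segment_convex K :=
  forall x y (t : R), K x -> K y -> 0 <= t <= 1 -> K (x + t *: (y - x)).

Lemma line_continuous x d : continuous (fun t : R => x + t *: d).
Proof.
move=> t; apply: (cvgD (cvg_cst x)).
exact: scalel_continuous.
Qed.

(** If the segment avoided the boundary, the parameters of its points in [K] would form a nonempty
    open and closed subset of the connected interval from 0 to 1. *)
Lemma segment_meets_boundary K x y : closed K -> K x -> ~ K y ->
  exists2 t : R, 0 <= t <= 1 & boundary K (x + t *: (y - x)).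
Proof.
move=> clK Kx nKy; apply: contrapT => nb.
pose f (t : R) := x + t *: (y - x).
have cf : continuous f by apply: line_continuous.
have E : `[0, 1]%classic `&` f @^-1` (interior K) = `[0, 1]%classic `&` f @^-1` K.
  apply/seteqP; split => t [/= t01 h]; split => //=.
    exact: interior_subset.
  apply: contrapT => ni; apply: nb; exists t.
    by move: t01; rewrite in_itv.
  by split => //; apply: subset_closure.
have E1 : `[0, 1]%classic `&` f @^-1` K = `[0, 1]%classic.
  apply: segment_connected.
  - exists 0; split; first by rewrite /= in_itv /= lexx ler01.
    by rewrite /= /f scale0r addr0.
  - exists (f @^-1` (interior K)); last by rewrite E.
    by apply: open_comp => [t _|]; [apply: cf|apply: open_interior].
  - by exists (f @^-1` K) => //; apply: preimage_closed => // t _; apply: cf.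
have : `[0, 1]%classic (1 : R) by rewrite /= in_itv /= lexx ler01.
by rewrite -E1 => -[_]; rewrite /= /f scale1r addrC subrK.
Qed.

Lemma interior_segment K x y (t : R) : segment_convex K ->
  interior K x -> K y -> 0 <= t < 1 -> interior K (x + t *: (y - x)).
Proof.
move=> cK /nbhs_ballP[e /= e0 He] Ky /andP[t0 t1].
have t1' : 0 < 1 - t by rewrite subr_gt0.
apply/nbhs_ballP; exists ((1 - t) * e) => /=; first by rewrite mulr_gt0.
move=> z; rewrite -ball_normE /ball_ /= => hz.
(* The preimage of [z] under the homothety of centre [y] and ratio [1 - t], which maps the ball of
   radius [e] at [x] onto the ball considered here. *)
pose w := x + (1 - t)^-1 *: (z - (x + t *: (y - x))).
have -> : z = w + t *: (y - w).
  have nz : 1 - t != 0 by rewrite gt_eqF.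
  apply/rowP => i; rewrite /w !mxE; field.
  by [].
apply: cK => //; last by rewrite t0 ltW.
apply: He; rewrite -ball_normE /ball_ /= /w opprD addNKr normrN normrZ.
rewrite gtr0_norm ?invr_gt0 // mulrC ltr_pdivrMr //.
by rewrite -normrN opprB mulrC.
Qed.

Lemma ballP_rV x y (e : R) : 0 < e ->
  (forall i, `|x 0 i - y 0 i| < e) -> ball x e y.
Proof.
move=> e0 H; split => // i j; rewrite ord1 -ball_normE /ball_ /=; exact: H.
Qed.

Lemma ball_rVP x y (e : R) i : ball x e y -> `|x 0 i - y 0 i| < e.
Proof. by case=> e0 /(_ 0 i); rewrite -ball_normE. Qed.

(* Walk from an interior point to an exterior one, both close to [b], changing
   one coordinate at a time. *)
Lemma axis_crossing K b (e : R) : closed K -> segment_convex K ->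
  interior K !=set0 -> boundary K b -> 0 < e ->
  exists i x (s : R), [/\ interior K x, ~ K (x + s *: delta_mx 0 i),
    ball b e x & ball b e (x + s *: delta_mx 0 i)].
Proof.
move=> clK cK [p intp] [clb nib] e0.
have Kb : K b by apply: clK.
have [q iq bq] : exists2 q, interior K q & ball b e q.
  pose t := e / (e + `|p - b| + 1).
  have den : 0 < e + `|p - b| + 1 by rewrite ltr_wpDl // addr_ge0 // ltW.
  have t0 : 0 < t by rewrite divr_gt0.
  have t1 : t <= 1 by rewrite ler_pdivrMr // mul1r -addrA lerDl addr_ge0.
  exists (p + (1 - t) *: (b - p)).
    by apply: interior_segment => //; rewrite subr_ge0 t1 gtrBl t0.
  rewrite -ball_normE /ball_ /=.
  have -> : b - (p + (1 - t) *: (b - p)) = - (t *: (p - b)).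
    by apply/rowP => i; rewrite !mxE; ring.
  rewrite normrN normrZ gtr0_norm // /t mulrAC ltr_pdivrMr // ltr_pM2l //.
  by move: e0; set m := `|_|; lra.
have [z nKz bz] : exists2 z, ~ K z & ball b e z.
  apply: contrapT => H; apply: nib; apply/nbhs_ballP; exists e => // z bz.
  by apply: contrapT => nz; apply: H; exists z.
pose h (j : nat) : 'rV[R]_k := \row_i (if (i < j)%N then z 0 i else q 0 i).
have bh j : ball b e (h j).
  apply: ballP_rV => // i; rewrite mxE.
  by case: ifP => _; apply: ball_rVP.
have hk : ~ interior K (h k).
  move=> /interior_subset; suff -> : h k = z by [].
  by apply/rowP => i; rewrite mxE ltn_ord.
(* At the first [j] where the walk is out of the interior, exactly one coordinate was changed since
   the last interior point. *)
have : exists j, `[< ~ interior K (h j) >] by exists k; apply/asboolP.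
move=> /ex_minnP[[|j]] /asboolP nj minj.
  case: nj; suff -> : h 0%N = q by [].
  by apply/rowP => i; rewrite mxE.
have ij : interior K (h j).
  apply: contrapT => nij; have /minj : `[< ~ interior K (h j) >] by apply/asboolP.
  by rewrite ltnn.
have jk : (j < k)%N by apply: minj; apply/asboolP.
pose i := Ordinal jk; pose s := z 0 i - q 0 i.
have hS : h j.+1 = h j + s *: delta_mx 0 i.
  apply/rowP => l; rewrite !mxE eqxx /= ltnS leq_eqVlt -val_eqE /=.
  case: (ltngtP l j) => lj; first by rewrite /= mulr0n mulr0 addr0.
    by rewrite /= mulr0n mulr0 addr0.
  have -> : l = i by apply/val_inj.
  by rewrite /= mulr1n mulr1 addrC subrK.
move: (bh j) (bh j.+1) hS nj ij; move: (h j) (h j.+1) => x y.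
move: i s => i s bx b_y yE ny ix {h bh hk minj jk nib nKz}.
have /nbhs_ballP[r /= r0 Hr] : nbhs y (ball b e).
  by apply: open_nbhs_nbhs; split; [apply: ball_open|].
have [u u0 Hu] : exists2 u : R, 0 < u & u * `|s *: delta_mx 0 i : 'rV[R]_k| < r.
  move: (normr_ge0 (s *: delta_mx 0 i : 'rV[R]_k)).
  move: `|_| => m m0; have den : 0 < m + 1 by rewrite ltr_wpDl.
  exists (r / (m + 1)); first by rewrite divr_gt0.
  by rewrite mulrAC ltr_pdivrMr // ltr_pM2l // ltrDl.
(* [y] is not interior but may still lie in [K]. Slightly beyond it the axis has left [K], otherwise
   [y] would be strictly inside a segment starting at the interior point [x], hence interior. *)
exists i, x, ((1 + u) * s).
have Eend : x + ((1 + u) * s) *: delta_mx 0 i = y + u *: (s *: delta_mx 0 i).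
  by rewrite yE; apply/rowP => l; rewrite !mxE; ring.
have nu : 1 + u != 0 by rewrite gt_eqF // addr_gt0.
split => //.
  move=> Ku; apply: ny.
  have -> : y = x + (1 + u)^-1 *: (x + ((1 + u) * s) *: delta_mx 0 i - x).
    by rewrite yE addrAC subrr add0r scalerA mulrA mulVf // mul1r.
  apply: interior_segment => //.
  by rewrite invr_ge0 addr_ge0 ?(ltW u0) //= invf_lt1 ?ltrDl ?addr_gt0.
rewrite Eend; apply: Hr; rewrite -ball_normE /ball_ /=.
by rewrite opprD addNKr normrN normrZ (gtr0_norm u0).
Qed.

Lemma boundary_nonempty K : closed K -> interior K !=set0 -> K != setT ->
  boundary K !=set0.
Proof.
move=> clK [p /interior_subset Kp] nT.
have [z nKz] : exists z, ~ K z.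
  apply: contrapT => H; move/eqP: nT; apply; apply/seteqP; split => // z _.
  by apply: contrapT => nz; apply: H; exists z.
by have [t _ bt] := segment_meets_boundary clK Kp nKz; exists (p + t *: (z - p)).
Qed.

End Convex.

(** * Equations of the algebraic boundary *)

Section AlgebraicBoundary.
Variables (R : realType) (k : nat).
Implicit Types (K : set 'rV[R]_k) (p q : mpoly.mpoly k R[i]).

Definition boundary_ideal K : set (mpoly.mpoly k R[i]) :=
  [set p | forall x, boundary K x -> peval p (complexify x) = 0].

Lemma algebraic_boundaryE K :
  algebraic_boundary K = zero_locus (boundary_ideal K).
Proof.
apply/seteqP; split => z.
  apply: (smallest_sub (X := zero_locus (boundary_ideal K))).
    by exists (boundary_ideal K).
  by move=> _ [x bx <-] p; apply.
move=> h V [[I ->] sub] p Ip; apply: h => x bx.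
by apply: (sub (complexify x)) Ip; exists x.
Qed.

Lemma vanishes_on_algebraic_boundary K p :
  vanishes_on p (algebraic_boundary K) <-> boundary_ideal K p.
Proof.
rewrite algebraic_boundaryE; split => [h x bx|Ip z]; last exact.
by apply: h => q; apply.
Qed.

Lemma pevalM p q z : peval (p * q) z = peval p z * peval q z.
Proof. exact: mpoly.mevalM. Qed.

Lemma pevalD p q z : peval (p + q) z = peval p z + peval q z.
Proof. exact: mpoly.mevalD. Qed.

Lemma prime_factor_vanishing (f : mpoly.mpoly k R[i]) z :
  f != 0 -> peval f z = 0 ->
  exists p g, [/\ prime_elt p, f = g * p & peval p z = 0].
Proof.
move=> /factorial_mpoly; elim=> {f} [u uu u0|p a pp _ IH].
  have := congr1 (fun f => peval f z) (mulrV uu).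
  rewrite pevalM u0 mul0r /peval mpoly.meval1 => /eqP.
  by rewrite eq_sym oner_eq0.
rewrite pevalM => /eqP; rewrite mulf_eq0 => /orP[/eqP pz|/eqP/IH].
  by exists p, a; rewrite mulrC.
by case=> q [g [qp -> qz]]; exists q, (p * g); rewrite mulrA.
Qed.

Lemma pdegree_eq0 p : pdegree p = 0%N -> p = mpoly.mpolyC k (mpoly.mcoeff mpoly.mnm0 p).
Proof.
by move=> h; apply/mpoly.msize1_polyC; move: h; rewrite /pdegree; case: mpoly.mmeasure => [|[]].
Qed.

Lemma prime_pdegree p : prime_elt p -> (0 < pdegree p)%N.
Proof.
move=> [p0 pu _]; rewrite lt0n; apply: contraNneq pu => /pdegree_eq0 E.
rewrite E rmorph_unit // unitfE.
by apply: contraNneq p0 => c0; rewrite E c0 mpoly.mpolyC0.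
Qed.

Lemma pdegreeM p q : p != 0 -> q != 0 ->
  pdegree (p * q) = (pdegree p + pdegree q)%N.
Proof.
move=> p0 q0; rewrite /pdegree mpoly.msizeM //.
rewrite (mpoly.mpolySpred _ p0) (mpoly.mpolySpred _ q0); lia.
Qed.

(* If a prime [p] vanished on a piece of the boundary where [q] vanishes too,
   eliminating the variable of an axis that crosses this piece would give a
   nonzero polynomial vanishing on an open set. *)
Lemma prime_vanishing_divides K b (e : R) p q :
  closed K -> segment_convex K -> interior K !=set0 -> boundary K b -> 0 < e ->
  prime_elt p -> boundary_ideal K q ->
  (forall x, boundary K x -> ball b e x -> peval p (complexify x) = 0) ->
  divides p q.
Proof.
move=> clK cK iK bb e0 pp Iq pz; apply: contrapT => npq.
have [i [x [s [ix ny bx b_y]]]] := axis_crossing clK cK iK bb e0.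
have [a [c [r [r0 E rI]]]] := eliminate_var i pp npq.
move/eqP: r0; apply.
move: ix => /nbhs_ballP[e1 /= e10 He1].
have /nbhs_ballP[e2 /= e20 He2] : nbhs (x + s *: delta_mx 0 i) (~` K).
  by apply: open_nbhs_nbhs; split => //; apply: closed_openC.
have /nbhs_ballP[e3 /= e30 He3] : nbhs x (ball b e).
  by apply: open_nbhs_nbhs; split => //; apply: ball_open.
have /nbhs_ballP[e4 /= e40 He4] : nbhs (x + s *: delta_mx 0 i) (ball b e).
  by apply: open_nbhs_nbhs; split => //; apply: ball_open.
have [e' e'0 [l1 l2 l3 l4]] : exists2 e' : R, 0 < e' &
    [/\ e' <= e1, e' <= e2, e' <= e3 & e' <= e4].
  exists (Num.min (Num.min e1 e2) (Num.min e3 e4)).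
    by rewrite !lt_min e10 e20 e30 e40.
  by split; rewrite !ge_min lexx ?orbT.
apply: (@mpoly_eq0_ball _ _ _ x _ e'0) => y xy.
have Ky : K y by apply: He1; apply: le_ball xy.
have xy2 : ball (x + s *: delta_mx 0 i) e' (y + s *: delta_mx 0 i).
  by move: xy; rewrite -!ball_normE /ball_ /= opprD addrACA subrr addr0.
have nKy : ~ K (y + s *: delta_mx 0 i) by apply: He2; apply: le_ball xy2.
have b1 : ball b e y by apply: He3; apply: le_ball xy.
have b2 : ball b e (y + s *: delta_mx 0 i) by apply: He4; apply: le_ball xy2.
(* Each [y] near [x] has a boundary point [w] on its parallel to axis [i]. There [p] and [q] vanish,
   hence [r], which does not see the coordinate in which [w] and [y] differ. *)
have [t t01 bw] := segment_meets_boundary clK Ky nKy.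
set w := y + _ in bw.
have bew : ball b e w.
  move: t01 => /andP[t0 t1]; apply: ballP_rV => // j.
  have := ball_rVP j b1; have := ball_rVP j b2.
  move: (b 0 j) => bj; rewrite /w !mxE; move: (y 0 j) (s * _) => yj dj.
  rewrite !ltr_norml => /andP[h1 h2] /andP[h3 h4].
  rewrite addrAC subrr add0r.
  have [dj0|dj0] := lerP dj 0.
    have : t * dj <= 0 by rewrite mulr_ge0_le0.
    have : dj <= t * dj by rewrite -[leLHS]mul1r ler_wnM2r.
    by move=> *; apply/andP; split; lra.
  have : 0 <= t * dj by rewrite mulr_ge0 // ltW.
  have : t * dj <= dj by rewrite -[leRHS]mul1r ler_wpM2r // ltW.
  by move=> *; apply/andP; split; lra.
have rw : peval r (complexify w) = 0.
  by rewrite -E pevalD !pevalM pz // Iq // !mulr0 addr0.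
rewrite -[RHS]rw; apply: rI => j ji; rewrite !mxE.
by rewrite (negPf ji) andbF !mulr0 addr0 subrr mulr0 addr0.
Qed.

(** Let [f] be of least degree among the nonzero polynomials vanishing on the boundary. For a prime
    factor [p] of [f], minimality gives a boundary point where the cofactor is nonzero. Near it [p]
    vanishes on the boundary, so [p] divides every [q] of the ideal, and each zero of [f] is a zero
    of [q]. *)
Theorem algebraic_boundary_hypersurface K :
  closed K -> segment_convex K -> interior K !=set0 -> K != setT ->
  (exists2 p, p != 0 & boundary_ideal K p) ->
  is_hypersurface (algebraic_boundary K) /\
  exists d, has_degree (algebraic_boundary K) d.
Proof.
move=> clK cK iK KT [p0 p0n p0I].
pose P d := `[< exists p, [/\ p != 0, boundary_ideal K p & pdegree p = d] >].
have exP : exists d, P d by exists (pdegree p0); apply/asboolP; exists p0.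
case: (ex_minnP exP) => d /asboolP[f [f0 fI df]] mind.
have minf p : p != 0 -> boundary_ideal K p -> (d <= pdegree p)%N.
  by move=> pn pI; apply: mind; apply/asboolP; exists p.
have dpos : (0 < pdegree f)%N.
  have [b bb] := boundary_nonempty clK iK KT.
  rewrite lt0n; apply: contraNneq f0 => /pdegree_eq0 E.
  have := fI _ bb; rewrite E /peval mpoly.mevalC => ->.
  by rewrite mpoly.mpolyC0.
split.
  exists f; split => //; rewrite algebraic_boundaryE; apply/seteqP; split => z.
    by move=> h _ ->; apply: h.
  move=> /(_ f erefl) fz q qI; apply: contrapT => qz.
  have [p [g [pp fE pz]]] := prime_factor_vanishing f0 fz.
  have [pn _ _] := pp.
  have gn : g != 0 by apply: contraNneq f0; rewrite fE => ->; rewrite mul0r.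
  have [b bb gb] : exists2 b, boundary K b & peval g (complexify b) != 0.
    apply: contrapT => H.
    have : boundary_ideal K g.
      move=> x bx; apply/eqP/contraT => gx; by case: H; exists x.
    move=> /(minf _ gn); rewrite -df fE pdegreeM //.
    by have := prime_pdegree pp; lia.
  have [e e0 He] := peval_neq0_ball gb.
  have [c qE] : divides p q.
    apply: (prime_vanishing_divides clK cK iK bb e0 pp qI) => x bx bex.
    have := fI _ bx; rewrite fE pevalM => /eqP.
    by rewrite mulf_eq0 (negPf (He _ bex)) => /eqP.
  by apply: qz; rewrite qE pevalM pz mulr0.
exists d; split.
  exists f; split => //; first exact/eqP.
  exact/vanishes_on_algebraic_boundary.
by move=> p /eqP pn /vanishes_on_algebraic_boundary; apply: minf.
Qed.

End AlgebraicBoundary.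

(** * Boundaries of definable sets *)

Section Definable.
Variable R : realType.
Implicit Types (P Q : (nat -> R) -> Prop) (F G : (nat -> R) -> R).

(** Environments are total functions; a finite list is padded with zeros. *)
Definition definable P := exists f, forall e, ord.holds e f <-> P (nth 0 e).

Definition polynomial_fun F := exists t, forall e, GRing.eval e t = F (nth 0 e).

Lemma polynomial_cst c : polynomial_fun (fun=> c).
Proof. by exists (GRing.Const c). Qed.

Lemma polynomial_var j : polynomial_fun (fun e => e j).
Proof. by exists (GRing.Var R j). Qed.

Lemma polynomial_add F G :
  polynomial_fun F -> polynomial_fun G -> polynomial_fun (fun e => F e + G e).
Proof. by move=> [s hs] [t ht]; exists (GRing.Add s t) => e /=; rewrite hs ht. Qed.

Lemma polynomial_mul F G :
  polynomial_fun F -> polynomial_fun G -> polynomial_fun (fun e => F e * G e).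
Proof. by move=> [s hs] [t ht]; exists (GRing.Mul s t) => e /=; rewrite hs ht. Qed.

Lemma polynomial_sum (I : Type) (r : seq I) (F : I -> (nat -> R) -> R) :
  (forall i, polynomial_fun (F i)) ->
  polynomial_fun (fun e => \sum_(i <- r) F i e).
Proof.
move=> H; elim: r => [|i r [t ht]].
  by exists (GRing.Const 0) => e /=; rewrite big_nil.
have [s hs] := H i.
by exists (GRing.Add s t) => e /=; rewrite big_cons hs ht.
Qed.

Lemma definable_le F G : polynomial_fun F -> polynomial_fun G ->
  definable (fun e => F e <= G e).
Proof. by move=> [s hs] [t ht]; exists (ord.Le s t) => e /=; rewrite hs ht. Qed.

Lemma definable_imp P Q : definable P -> definable Q ->
  definable (fun e => P e -> Q e).
Proof.
move=> [f hf] [g hg]; exists (ord.Implies f g) => e /=.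
by split=> H /hf /H /hg.
Qed.

Definition update_range (a n : nat) (w e : nat -> R) (j : nat) : R :=
  if (a <= j < a + n)%N then w j else e j.

(** Quantifying over a function [w] costs only [n] first-order quantifiers, because [update_range]
    reads [w] on a block of [n] indices. *)
Lemma definable_forall a n P : definable P ->
  definable (fun e => forall w, P (update_range a n w e)).
Proof.
move=> dP; elim: n => [|n [f hf]].
  case: dP => f hf; exists f => e; rewrite hf.
  suff E w : update_range a 0 w (nth 0 e) = nth 0 e.
    by split => [h w|/(_ (fun=> 0))]; rewrite E.
  by apply/funext => j; rewrite /update_range addn0; case: ifP => //; lia.
exists (ord.Forall (a + n) f) => e /=.
have E x w : update_range a n w (nth 0 (set_nth 0 e (a + n) x)) =
  update_range a n.+1 (fun j => if j == (a + n)%N then x else w j) (nth 0 e).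
  apply/funext => j; rewrite /update_range nth_set_nth /=.
  case: eqVneq => [->|ne].
    by rewrite addnS leqnn ltnn leq_addr.
  suff -> : (a <= j < a + n.+1)%N = (a <= j < a + n)%N by [].
  by apply/idP/idP; lia.
split=> [H w|H x].
  have /hf/(_ w) := H (w (a + n)%N); rewrite E.
  suff -> : (fun j => if j == (a + n)%N then w (a + n)%N else w j) = w by [].
  by apply/funext => j; case: eqVneq => [->|].
by apply/hf => w; rewrite E.
Qed.

End Definable.

(** * Quantifier elimination and polynomials vanishing on boundaries *)

Section QuantifierElimination.
Variables (R : realType) (k : nat).
Implicit Types (c y : 'rV[R]_k) (f : ord.formula R) (t : GRing.term R).
Local Open Scope complex_scope.

Definition row_env c : seq R := [seq c 0 i | i <- enum 'I_k].

Lemma nth_row_env c j (jk : (j < k)%N) : nth 0 (row_env c) j = c 0 (Ordinal jk).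
Proof.
rewrite (nth_map (Ordinal jk)) ?size_enum_ord //; congr (c 0 _).
by apply/val_inj; rewrite /= nth_enum_ord.
Qed.

(** Variables of index at least [k] become 0, in agreement with the padding of environments. The
    value at [GRing.Inv] is a dummy, excluded by [GRing.rterm]. *)
Fixpoint mpoly_of_term t : mpoly.mpoly k R[i] :=
  match t with
  | GRing.Var j => if insub j is Some i then mpoly.mpolyX _ (mpoly.mnm1 (i : 'I_k))
                   else 0
  | GRing.Const r => mpoly.mpolyC k r%:C
  | GRing.NatConst n => n%:R
  | GRing.Add s t => mpoly_of_term s + mpoly_of_term t
  | GRing.Opp s => - mpoly_of_term s
  | GRing.NatMul s n => mpoly_of_term s *+ n
  | GRing.Mul s t => mpoly_of_term s * mpoly_of_term t
  | GRing.Exp s n => mpoly_of_term s ^+ n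
  | GRing.Inv _ => 0
  end.

Lemma peval_term t c : GRing.rterm t ->
  peval (mpoly_of_term t) (complexify c) = (GRing.eval (row_env c) t)%:C.
Proof.
rewrite /peval; elim: t => //=.
- move=> j _; case: insubP => [i ik ji|]; last first.
    rewrite -leqNgt => kj; rewrite nth_default ?rmorph0 //.
    by rewrite size_map size_enum_ord.
  rewrite mpoly.mevalXU mxE; congr (_%:C).
  have jk : (j < k)%N by rewrite -ji ltn_ord.
  by rewrite nth_row_env; congr (c 0 _); apply/val_inj.
- by move=> r _; rewrite mpoly.mevalC.
- by move=> n _; rewrite !rmorph_nat.
- by move=> s IHs t IHt /andP[/IHs {}IHs /IHt {}IHt]; rewrite !rmorphD /= IHs IHt.
- by move=> s IHs /IHs {}IHs; rewrite !rmorphN /= IHs.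
- by move=> s IHs n /IHs {}IHs; rewrite !rmorphMn /= IHs.
- by move=> s IHs t IHt /andP[/IHs {}IHs /IHt {}IHt]; rewrite !rmorphM /= IHs IHt.
- by move=> s IHs n /IHs {}IHs; rewrite !rmorphXn /= IHs.
Qed.

Lemma eval_term_continuous t : GRing.rterm t ->
  continuous (fun c => GRing.eval (row_env c) t).
Proof.
move=> rt; have -> : (fun c => GRing.eval (row_env c) t) =
    (fun c => complex.Re (peval (mpoly_of_term t) (complexify c))).
  by apply/funext => c; rewrite peval_term.
exact: (peval_continuous _).1.
Qed.

(** [h] depends only on the sign of a nonzero argument, and the sign of [s - t] is locally constant
    off its zeros. If [s - t] is the zero polynomial, the atom is constant everywhere. *)
Lemma atom_locally_constant (h : R -> bool) (s t : GRing.term R) :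
  GRing.rterm s -> GRing.rterm t ->
  (forall a b, 0 < a * b -> h a = h b) ->
  exists2 p, p != 0 & forall c, peval p (complexify c) != 0 ->
    exists2 e : R, 0 < e & forall y, ball c e y ->
      h (GRing.eval (row_env y) s - GRing.eval (row_env y) t) =
      h (GRing.eval (row_env c) s - GRing.eval (row_env c) t).
Proof.
move=> rs rt hh; pose q := mpoly_of_term s - mpoly_of_term t.
have Eq c : peval q (complexify c) =
    (GRing.eval (row_env c) s - GRing.eval (row_env c) t)%:C.
  by rewrite rmorphB /= -!peval_term // /peval mpoly.mevalB.
have [q0|q0] := eqVneq q 0.
  exists 1; first exact: oner_neq0.
  move=> c _; exists 1 => // y _.
  have E z : GRing.eval (row_env z) s - GRing.eval (row_env z) t = 0.
    by apply: complexI; rewrite -Eq q0 /peval mpoly.meval0.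
  by rewrite !E.
exists q => // c; rewrite Eq.
set F := fun c => GRing.eval (row_env c) s - GRing.eval (row_env c) t.
rewrite -/(F c) => Fc.
have Fc0 : F c != 0 by apply: contraNneq Fc => ->.
have cF : continuous F.
  by move=> z; exact: (continuousB (@eval_term_continuous _ rs z) (@eval_term_continuous _ rt z)).
have cFF : continuous (fun y => F y * F c).
  by move=> z; apply: continuousM; [apply: cF|apply: cst_continuous].
have /nbhs_ballP[e e0 He] : nbhs c [set y | 0 < F y * F c].
  apply: (cFF c [set z | 0 < z]); apply: open_nbhs_nbhs; split.
    exact: open_gt.
  by rewrite /= -expr2 exprn_even_gt0.
by exists e => // y /He; apply: hh.
Qed.

Lemma qf_locally_constant f : ord.qf_form f -> ord.rformula f ->
  exists2 p, p != 0 & forall c, peval p (complexify c) != 0 ->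
    exists2 e : R, 0 < e & forall y, ball c e y ->
      ord.qf_eval (row_env y) f = ord.qf_eval (row_env c) f.
Proof.
have sgn (a b : R) : 0 < a * b -> (0 < a) = (0 < b) /\ (a == 0) = (b == 0).
  move=> ab; have [a0|a0|a0] := ltrgt0P a; have [b0|b0|b0] := ltrgt0P b => //; nra.
have bin (op : bool -> bool -> bool) (f1 f2 : ord.formula R) :
    (exists2 p, p != 0 & forall c, peval p (complexify c) != 0 ->
    exists2 e : R, 0 < e & forall y, ball c e y ->
      ord.qf_eval (row_env y) f1 = ord.qf_eval (row_env c) f1) ->
    (exists2 p, p != 0 & forall c, peval p (complexify c) != 0 ->
    exists2 e : R, 0 < e & forall y, ball c e y ->
      ord.qf_eval (row_env y) f2 = ord.qf_eval (row_env c) f2) ->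
    exists2 p, p != 0 & forall c, peval p (complexify c) != 0 ->
    exists2 e : R, 0 < e & forall y, ball c e y ->
      op (ord.qf_eval (row_env y) f1) (ord.qf_eval (row_env y) f2) =
      op (ord.qf_eval (row_env c) f1) (ord.qf_eval (row_env c) f2).
  move=> [p p0 hp] [q q0 hq]; exists (p * q); first by rewrite mulf_neq0.
  move=> c; rewrite pevalM mulf_eq0 negb_or => /andP[/hp[e e0 he] /hq[d d0 hd]].
  exists (Num.min e d); first by rewrite lt_min e0.
  move=> y by_; rewrite he; last by apply: le_ball by_; rewrite ge_min lexx.
  by rewrite hd //; apply: le_ball by_; rewrite ge_min lexx orbT.
elim: f => //=.
- move=> b _ _; exists 1; first exact: oner_neq0.
  by move=> c _; exists 1.
- move=> s t _ /andP[rs rt].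
  have [a b /sgn[]//|p p0 hp] := @atom_locally_constant (fun x => x == 0) s t rs rt.
  exists p => // c /hp[e e0 he]; exists e => // y /he.
  by rewrite !subr_eq0.
- move=> s t _ /andP[rs rt].
  have [a b /sgn[]//|p p0 hp] := @atom_locally_constant (fun x => 0 < x) t s rt rs.
  exists p => // c /hp[e e0 he]; exists e => // y /he.
  by rewrite !subr_gt0.
- move=> s t _ /andP[rs rt].
  have [a b /sgn[h _]|p p0 hp] := @atom_locally_constant (fun x => ~~ (0 < x)) s t rs rt.
    by rewrite h.
  exists p => // c /hp[e e0 he]; exists e => // y /he.
  by rewrite !subr_gt0 -!leNgt.
- by move=> f1 IH1 f2 IH2 /andP[q1 q2] /andP[r1 r2]; apply: (bin andb); auto.
- by move=> f1 IH1 f2 IH2 /andP[q1 q2] /andP[r1 r2]; apply: (bin orb); auto.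
- by move=> f1 IH1 f2 IH2 /andP[q1 q2] /andP[r1 r2]; apply: (bin implb); auto.
move=> f IH qf rf; have [p p0 hp] := IH qf rf.
by exists p => // c /hp[e e0 he]; exists e => // y /he ->.
Qed.

(** After quantifier elimination, membership in [K] is locally constant wherever the product [p] of
    the atomic polynomials is nonzero, so no such point is on the boundary. *)
Theorem definable_boundary_ideal (K : set 'rV[R]_k) P : definable P ->
  (forall c, K c <-> P (nth 0 (row_env c))) ->
  exists2 p, p != 0 & boundary_ideal K p.
Proof.
move=> [f hf] KP.
pose g := ord.quantifier_elim (@wproj R) (ord.to_rform f).
have /andP[qg rg] : ord.qf_form g && ord.rformula g.
  exact: (ord.quantifier_elim_wf (@wf_QE_wproj R) (ord.to_rform_rformula f)).
have Kg c : K c <-> ord.qf_eval (row_env c) g.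
  rewrite KP -hf; apply: iff_trans (rwP (rcf_satP _ _)); exact: iff_refl.
have [p p0 hp] := qf_locally_constant qg rg.
exists p => // x [clx nix]; apply/eqP/contraT => /hp[e e0 he]; case: nix.
have /clx[y [/Kg Ky bxy]] : nbhs x (ball x e) by apply: nbhsx_ballx.
by apply/nbhs_ballP; exists e => // z bxz; apply/Kg; rewrite (he _ bxz) -(he _ bxy).
Qed.

End QuantifierElimination.

(** * Vertices and facets of the polar *)

Section Inner.
Variables (R : realType) (k : nat).
Implicit Types (c d x y : 'rV[R]_k) (t : R).

Lemma innerC c x : inner c x = inner x c.
Proof. by apply: eq_bigr => i _; rewrite mulrC. Qed.

Lemma innerDl c d x : inner (c + d) x = inner c x + inner d x.
Proof. by rewrite -big_split; apply: eq_bigr => i _; rewrite !mxE mulrDl. Qed.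

Lemma innerZl t c x : inner (t *: c) x = t * inner c x.
Proof. by rewrite mulr_sumr; apply: eq_bigr => i _; rewrite !mxE mulrA. Qed.

Lemma innerBl c d x : inner (c - d) x = inner c x - inner d x.
Proof. by rewrite -scaleN1r innerDl innerZl mulN1r. Qed.

Lemma innerZr t c x : inner c (t *: x) = t * inner c x.
Proof. by rewrite !(innerC c) innerZl. Qed.

Lemma innerBr c x y : inner c (x - y) = inner c x - inner c y.
Proof. by rewrite !(innerC c) innerBl. Qed.

Lemma inner0r c : inner c 0 = 0.
Proof. by rewrite -(scale0r 0) innerZr mul0r. Qed.

Lemma inner_ge0 c : 0 <= inner c c.
Proof. by apply: sumr_ge0 => i _; rewrite -expr2 sqr_ge0. Qed.

Lemma inner_eq0 c : inner c c = 0 -> c = 0.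
Proof.
move=> h; apply/rowP => i; rewrite mxE; apply/eqP.
have /eqP := h; rewrite psumr_eq0 => [/allP/(_ i)|j _]; last first.
  by rewrite -expr2 sqr_ge0.
by rewrite mem_index_enum mulf_eq0 orbb; apply.
Qed.

Lemma inner_delta c i : inner c (delta_mx 0 i) = c 0 i.
Proof.
rewrite /inner (bigD1 i) //= big1 => [|j ji]; first by rewrite mxE !eqxx mulr1 addr0.
by rewrite mxE (negPf ji) andbF mulr0.
Qed.

Lemma inner_continuous x : continuous (fun c => inner c x).
Proof.
apply: continuous_big => [|i _ c]; first exact: add_continuous.
by apply: (@continuousM _ _ (fun c : 'rV[R]_k => c 0 i) (fun=> x 0 i));
  [apply: coord_continuous|apply: cst_continuous].
Qed.

Variable C : set 'rV[R]_k.

Lemma polar_closed : closed (polar C).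
Proof.
have -> : polar C = \bigcap_(x in C) [set c | inner c x <= 1].
  by apply/seteqP; split => c h x; apply: h.
apply: closed_bigI => x _.
apply: (preimage_closed (f := fun c => inner c x) (D := [set z | z <= 1])).
  by move=> c _; apply: inner_continuous.
exact: closed_le.
Qed.

Lemma polar_convex : segment_convex (polar C).
Proof.
move=> c d t hc hd /andP[t0 t1] x Cx.
rewrite innerDl innerZl innerBl; have := hc x Cx; have := hd x Cx; nra.
Qed.

Definition normal_vector v c := forall x, C x -> inner c x <= inner c v.

Definition vertex v := C v /\
  exists c r, 0 < r /\ forall c', ball c r c' -> normal_vector v c'.

Hypothesis C0 : interior C 0.

Lemma small_multiple_in c : exists2 t : R, 0 < t & C (t *: c).
Proof.
have /nbhs_ballP[e /= e0 He] := C0.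
have n0 : 0 < `|c| + 1 by rewrite ltr_wpDl.
exists (e / (`|c| + 1)); first by rewrite divr_gt0.
apply: He; rewrite -ball_normE /ball_ /= sub0r normrN normrZ gtr0_norm ?divr_gt0 //.
by rewrite mulrAC ltr_pdivrMr // ltr_pM2l // ltrDl.
Qed.

(** The constraint at [v] is tight, so enlarging [c] by any factor above 1 leaves the polar. *)
Lemma polar_boundary v c : C v -> normal_vector v c -> inner c v = 1 ->
  boundary (polar C) c.
Proof.
move=> Cv nc cv1; have pc : polar C c by move=> x /nc; rewrite cv1.
split; first exact: subset_closure.
move=> /nbhs_ballP[e /= e0 He].
have n0 : 0 < `|c| + 1 by rewrite ltr_wpDl.
pose t := e / (`|c| + 1); have t0 : 0 < t by rewrite divr_gt0.
have /He/(_ v Cv) : ball c e (c + t *: c).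
  rewrite -ball_normE /ball_ /= opprD addNKr normrN normrZ gtr0_norm //.
  by rewrite mulrAC ltr_pdivrMr // ltr_pM2l // ltrDl.
by rewrite innerDl innerZl cv1 mulr1 gerDl leNgt t0.
Qed.

Hypothesis k_gt0 : (0 < k)%N.

(** It suffices to rescale once [inner c v] is positive. If it were 0, then [c = 0], as a small
    multiple of [c] lies in [C]; then every vector is normal at [v], which forces [v = 0] and
    contradicts that [C] contains a positive multiple of a basis vector. *)
Lemma vertex_normal v : vertex v ->
  exists c r, [/\ 0 < r, inner c v = 1 &
    forall c', ball c r c' -> normal_vector v c'].
Proof.
move=> [Cv [c [r [r0 H]]]].
suff cv : 0 < inner c v.
  exists ((inner c v)^-1 *: c), ((inner c v)^-1 * r).
  split; first by rewrite mulr_gt0 // invr_gt0.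
    by rewrite innerZl mulVf // gt_eqF.
  move=> c'; rewrite -ball_normE /ball_ /= => h x Cx.
  have : normal_vector v (inner c v *: c').
    apply: H; rewrite -ball_normE /ball_ /=.
    rewrite -[X in X - _](scale1r c) -(mulfV (lt0r_neq0 cv)).
    by rewrite -scalerA -scalerBr normrZ gtr0_norm // -ltr_pdivlMl.
  by move=> /(_ x Cx); rewrite !innerZl ler_pM2l.
have nc : normal_vector v c by apply: H; apply: ballxx.
have [t t0 Ct] := small_multiple_in c.
rewrite lt_neqAle eq_sym; apply/andP; split; last first.
  have := nc 0 (interior_subset C0); by rewrite inner0r.
apply/negP => /eqP cv0.
have c0 : c = 0.
  apply: inner_eq0; apply/eqP; rewrite eq_le inner_ge0 andbT.
  have := nc _ Ct; rewrite cv0 innerZr.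
  by rewrite pmulr_rle0.
have nd d : normal_vector v d.
  have n0 : 0 < `|d| + 1 by rewrite ltr_wpDl.
  pose s := r / (`|d| + 1); have s0 : 0 < s by rewrite divr_gt0.
  have : normal_vector v (s *: d).
    apply: H; rewrite c0 -ball_normE /ball_ /= sub0r normrN normrZ gtr0_norm //.
    by rewrite mulrAC ltr_pdivrMr // ltr_pM2l // ltrDl.
  by move=> h x /h; rewrite !innerZl ler_pM2l.
have v0 : v = 0.
  apply: inner_eq0; apply/eqP; rewrite eq_le inner_ge0 andbT.
  have := nd (- v) 0 (interior_subset C0).
  by rewrite inner0r -scaleN1r innerZl mulN1r oppr_ge0.
have [s s0 Cs] := small_multiple_in (delta_mx 0 (Ordinal k_gt0)).
have := nd (delta_mx 0 (Ordinal k_gt0)) _ Cs.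
rewrite v0 inner0r innerZr inner_delta mxE !eqxx mulr1.
by rewrite leNgt s0.
Qed.

Lemma vertex_neq0 v : vertex v -> v != 0.
Proof.
move=> /vertex_normal[c [r [_ cv _]]]; apply/eqP => v0.
by move: cv; rewrite v0 inner0r => /eqP; rewrite eq_sym oner_eq0.
Qed.

(* The segment from a normal vector to [c] stays in [inner _ v = 1] and starts
   inside the facet of the polar that is dual to [v]. *)
Lemma facet_vanishing p v c : vertex v -> boundary_ideal (polar C) p ->
  inner c v = 1 -> peval p (complexify c) = 0.
Proof.
move=> vv Ip cv; have Cv := vv.1; have [c1 [r [r0 c1v H]]] := vertex_normal vv.
transitivity (peval p (complexify (c1 + 1 *: (c - c1)))).
  by rewrite scale1r addrC subrK.
rewrite peval_line; set q := mline _ _ _.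
suff -> : q = 0 by rewrite horner0.
have n0 : 0 < `|c - c1| + 1 by rewrite ltr_wpDl.
have e0 : 0 < r / (`|c - c1| + 1) by rewrite divr_gt0.
apply: (poly_eq0_interval e0) => t /andP[t0 te]; rewrite -peval_line.
apply: Ip; apply: (polar_boundary Cv); last first.
  by rewrite innerDl innerZl innerBl cv c1v subrr mulr0 addr0.
apply: H; rewrite -ball_normE /ball_ /= opprD addNKr normrN normrZ gtr0_norm //.
rewrite ltr_pdivlMr // in te; apply: le_lt_trans te.
by rewrite ler_pM2l // lerDl.
Qed.

Lemma polar_interior v : vertex v -> interior (polar C) !=set0.
Proof.
move=> /vertex_normal[c [r [r0 cv H]]].
have /nbhs_ballP[e /= e0 He] : nbhs c [set c' | inner c' v < 2].
  apply: (inner_continuous (x := v) (x0 := c) (t := [set z | z < 2])).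
  apply: open_nbhs_nbhs; split; first exact: open_lt.
  by rewrite /= cv; lra.
(* Normal vectors near [c] have inner product below 2 with [v], so their halves are in the polar. *)
exists (2^-1 *: c); apply/nbhs_ballP.
exists (2^-1 * Num.min r e) => /=; first by rewrite mulr_gt0 ?lt_min ?r0 ?e0 ?invr_gt0.
move=> y; rewrite -ball_normE /ball_ /= => h x Cx.
have yE : ball c (Num.min r e) (2 *: y).
  rewrite -ball_normE /ball_ /=.
  have -> : c - 2 *: y = 2 *: (2^-1 *: c - y).
    by rewrite scalerBr scalerA mulfV ?scale1r // pnatr_eq0.
  by rewrite normrZ gtr0_norm // -ltr_pdivlMl.
have y2 : inner (2 *: y) v < 2 by apply: He; apply: le_ball yE; rewrite ge_min lexx orbT.
have /H/(_ x Cx) : ball c r (2 *: y) by apply: le_ball yE; rewrite ge_min lexx.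
move: y2; rewrite !innerZl; lra.
Qed.

Lemma polar_neqT : polar C != setT.
Proof.
apply/eqP => E; have [t t0 Ct] := small_multiple_in (delta_mx 0 (Ordinal k_gt0)).
have : polar C ((2 / t) *: delta_mx 0 (Ordinal k_gt0)) by rewrite E.
move=> /(_ _ Ct); rewrite innerZl innerZr inner_delta mxE !eqxx mulr1.
by rewrite divfK ?gt_eqF //; lra.
Qed.

Local Open Scope complex_scope.

Definition linear_mpoly x : mpoly.mpoly k R[i] :=
  \sum_i mpoly.mpolyC k (x 0 i)%:C * mpoly.mpolyX _ (mpoly.mnm1 i).

Lemma meval_linear_mpoly x w :
  mpoly.meval w (linear_mpoly x) = \sum_i (x 0 i)%:C * w i.
Proof.
rewrite raddf_sum; apply: eq_bigr => i _ /=.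
by rewrite mpoly.mevalM mpoly.mevalC mpoly.mevalXU.
Qed.

Lemma linear_mpoly_neq0 x : x != 0 -> linear_mpoly x != 0.
Proof.
apply: contraNneq => E; apply/eqP/rowP => i; apply: complexI.
have := meval_linear_mpoly x (fun j => (j == i)%:R).
rewrite E mpoly.meval0 (bigD1 i) //= eqxx mulr1 big1 => [|j /negPf->].
  by rewrite addr0 mxE => <-.
by rewrite mulr0.
Qed.

(* On a generic line through the origin the facets cut out distinct points. *)
Theorem degree_ge_vertices (I : finType) (v : I -> 'rV[R]_k) p :
  injective v -> (forall i, vertex (v i)) ->
  p != 0 -> boundary_ideal (polar C) p -> (#|I| <= pdegree p)%N.
Proof.
move=> vinj vv p0 Ip.
(* Where [q] is nonzero, the direction [c] is generic: [p] is not identically zero on its line, and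
   the numbers [inner c (v i)] are nonzero and distinct. *)
pose q := p * ((\prod_i linear_mpoly (v i)) *
  \prod_i \prod_(j | j != i) linear_mpoly (v i - v j)).
have q0 : q != 0.
  rewrite !mulf_neq0 //.
    by apply/prodf_neq0 => i _; apply/linear_mpoly_neq0/vertex_neq0.
  apply/prodf_neq0 => i _; apply/prodf_neq0 => j ji; apply/linear_mpoly_neq0.
  by rewrite subr_eq0; apply: contraNneq ji => /vinj ->.
have finj : injective (fun n : nat => n%:R : R[i]).
  by move=> m n /eqP; rewrite eqr_nat => /eqP.
have [w] := exists_meval_neq0 finj q0; set W := _ \o _.
rewrite !mpoly.mevalM !mulf_eq0 !negb_or => /and3P[pW].
rewrite !rmorph_prod => /prodf_neq0 v0 /prodf_neq0 vij.
pose c : 'rV[R]_k := \row_i (w i)%:R.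
have WE i : W i = (c 0 i)%:C by rewrite mxE rmorph_nat.
have innerE x : mpoly.meval W (linear_mpoly x) = (inner c x)%:C.
  rewrite meval_linear_mpoly /inner rmorph_sum; apply: eq_bigr => i _.
  by rewrite rmorphM WE mulrC.
have cv0 i : inner c (v i) != 0.
  by have := v0 i isT; rewrite /= innerE; apply: contraNneq => ->.
have cvij i j : inner c (v i) = inner c (v j) -> i = j.
  move=> E; apply/eqP/contraT; rewrite eq_sym => ij.
  have := vij i isT; rewrite /= rmorph_prod => /prodf_neq0/(_ j ij) /=.
  by rewrite innerE innerBr E subrr eqxx.
pose l := mline (fun=> 0) (fun i => (c 0 i)%:C) p.
have lE t : l.[t%:C] = peval p (complexify (t *: c)).
  rewrite horner_mline; apply: mpoly.meval_eq => i.
  by rewrite !mxE rmorphM /= add0r mulrC.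
have l0 : l != 0.
  apply: contraNneq pW => E; have := lE 1; rewrite E horner0 scale1r => lE1.
  by apply/eqP; rewrite [RHS]lE1; apply: mpoly.meval_eq => i; rewrite WE [RHS]mxE.
(* The parameters at which the line meets the hyperplanes [inner _ (v i) = 1]. *)
pose s := [seq ((inner c (v i))^-1)%:C | i <- enum I].
have rs : all (root l) s.
  apply/allP => _ /mapP[i _ ->]; apply/eqP; rewrite lE.
  by apply: facet_vanishing (vv i) Ip _; rewrite innerZl mulVf.
have us : uniq s.
  by rewrite map_inj_uniq ?enum_uniq // => i j /complexI/invr_inj/cvij.
have := max_poly_roots l0 rs us; rewrite size_map -cardE => h.
have := leq_trans h (size_mline _ _ p).
by rewrite (mpoly.mpolySpred _ p0) ltnS.
Qed.

End Inner.

(** * Spectrahedra *)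

Section Spectrahedron.
Local Open Scope convex_scope.
Variables (R : realType) (k m : nat) (A0 : 'M[R]_m) (A : 'I_k -> 'M[R]_m).
Hypotheses (A0sym : A0^T = A0) (Asym : forall i, (A i)^T = A i).
Implicit Types (c x z : 'rV[R]_k).

Definition pencil x : 'M[R]_m := \sum_(i < k) x 0 i *: A i.

Definition spectrahedron : set 'rV[R]_k := [set x | psd (A0 + pencil x)].

Definition quad_form (M : 'M[R]_m) (v : 'rV[R]_m) : R := (v *m M *m v^T) 0 0.

Lemma quad_formE M v : quad_form M v = \sum_a \sum_b v 0 a * M a b * v 0 b.
Proof.
rewrite /quad_form mxE exchange_big /=; apply: eq_bigr => b _.
by rewrite !mxE mulr_suml.
Qed.

Lemma quad_formD M N v : quad_form (M + N) v = quad_form M v + quad_form N v.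
Proof. by rewrite /quad_form mulmxDr mulmxDl mxE. Qed.

Lemma quad_formZ t M v : quad_form (t *: M) v = t * quad_form M v.
Proof. by rewrite /quad_form -scalemxAr -scalemxAl mxE. Qed.

Lemma pencil_sym x : (pencil x)^T = pencil x.
Proof. by rewrite linear_sum; apply: eq_bigr => i _; rewrite linearZ /= Asym. Qed.

Lemma pencilD x z : pencil (x + z) = pencil x + pencil z.
Proof. by rewrite -big_split; apply: eq_bigr => i _; rewrite mxE scalerDl. Qed.

Lemma pencilZ t x : pencil (t *: x) = t *: pencil x.
Proof. by rewrite scaler_sumr; apply: eq_bigr => i _; rewrite mxE scalerA. Qed.

Lemma pencilB x z : pencil (x - z) = pencil x - pencil z.
Proof. by rewrite -scaleN1r pencilD pencilZ scaleN1r. Qed.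

Lemma spectrahedronP x :
  spectrahedron x <-> forall v, 0 <= quad_form (A0 + pencil x) v.
Proof.
by split => [[]//|h]; split=> //; rewrite linearD /= A0sym pencil_sym.
Qed.

Lemma quad_form_pencil x v :
  quad_form (pencil x) v = \sum_i x 0 i * quad_form (A i) v.
Proof.
rewrite /quad_form mulmx_sumr mulmx_suml summxE; apply: eq_bigr => i _.
exact: quad_formZ.
Qed.

Lemma spectrahedron_closed : closed spectrahedron.
Proof.
have -> : spectrahedron =
    \bigcap_v [set x : 'rV[R]_k | 0 <= quad_form A0 v + \sum_i x 0 i * quad_form (A i) v].
  apply/seteqP; split => x.
    by move=> /spectrahedronP h v _; have := h v; rewrite quad_formD quad_form_pencil.
  move=> h; apply/spectrahedronP => v; have := h v I.
  by rewrite quad_formD quad_form_pencil.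
apply: closed_bigI => v _.
pose f (x : 'rV[R]_k) := quad_form A0 v + inner x (\row_i quad_form (A i) v).
have -> : [set x : 'rV[R]_k | 0 <= quad_form A0 v + \sum_i x 0 i * quad_form (A i) v] =
    f @^-1` [set z | 0 <= z].
  apply/seteqP; split => x /=; rewrite /f /inner.
    by under [in X in _ -> X]eq_bigr do rewrite mxE.
  by under [in X in X -> _]eq_bigr do rewrite mxE.
apply: preimage_closed; last exact: closed_ge.
move=> x _.
exact: (cvgD (cvg_cst _) (@inner_continuous _ _ (\row_i quad_form (A i) v) x)).
Qed.

Lemma spectrahedron_convex :
  convex_set (spectrahedron : set (convex_lmodType 'rV[R]_k)).
Proof.
apply/convex_setW => x y; rewrite !inE => /spectrahedronP hx /spectrahedronP hy l l0 l1.
rewrite inE.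
apply/spectrahedronP => v; set t : R := l%:num.
have t0 : 0 <= t by exact: ltW.
have t1 : 0 <= 1 - t by rewrite subr_ge0 ltW.
suff -> : A0 + pencil (x <| l |> y) = t *: (A0 + pencil x) + (1 - t) *: (A0 + pencil y).
  by rewrite quad_formD !quad_formZ addr_ge0 // mulr_ge0.
have -> : pencil (x <| l |> y) = t *: pencil x + (1 - t) *: pencil y.
  by rewrite -!pencilZ -pencilD.
rewrite !scalerDr addrACA; congr (_ + _).
by rewrite -scalerDl addrCA subrr addr0 scale1r.
Qed.

Lemma has_psd_lift_spectrahedron : has_psd_lift spectrahedron m.
Proof.
exists k, spectrahedron, idfun; split; last by rewrite image_id.
by exists A0, A.
Qed.

(** A form that is at least [delta] times the identity absorbs any pencil with small coefficients;
    [B] bounds the pencil form relative to the size of [x]. *)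
Lemma spectrahedron_interior0 (delta : R) : 0 < delta ->
  (forall v, delta * quad_form 1%:M v <= quad_form A0 v) ->
  interior spectrahedron 0.
Proof.
move=> d0 H.
pose B := \sum_i \sum_a \sum_b `|A i a b|.
have B0 : 0 <= B by do 3 (apply: sumr_ge0 => ? _).
apply/nbhs_ballP; exists (delta / (B + 1)) => /=.
  by rewrite divr_gt0 // ltr_wpDl.
move=> x bx; apply/spectrahedronP => v; rewrite quad_formD.
have n1 : quad_form 1%:M v = \sum_a v 0 a ^+ 2.
  rewrite quad_formE; apply: eq_bigr => a _.
  rewrite (bigD1 a) //= big1 => [|b ba]; first by rewrite mxE eqxx mulr1 addr0.
  by rewrite mxE eq_sym (negPf ba) mulr0 mul0r.
have vab a b : `|v 0 a * v 0 b| <= quad_form 1%:M v.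
  have h : v 0 a ^+ 2 <= quad_form 1%:M v.
    by rewrite n1 (bigD1 a) //= lerDl sumr_ge0 // => j _; rewrite sqr_ge0.
  have h' : v 0 b ^+ 2 <= quad_form 1%:M v.
    by rewrite n1 (bigD1 b) //= lerDl sumr_ge0 // => j _; rewrite sqr_ge0.
  rewrite ler_norml; apply/andP; split.
    by have := sqr_ge0 (v 0 a + v 0 b); lra.
  by have := sqr_ge0 (v 0 a - v 0 b); lra.
have n0 : 0 <= quad_form 1%:M v by rewrite n1 sumr_ge0 // => a _; rewrite sqr_ge0.
suff h : `|quad_form (pencil x) v| <= delta * quad_form 1%:M v.
  have := H v; have := lerNnormlW h; lra.
rewrite quad_formE.
have xi i : `|x 0 i| <= delta / (B + 1).
  have := ball_rVP i bx; rewrite mxE sub0r normrN; exact: ltW.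
apply: (le_trans (ler_norm_sum _ _ _)).
apply: (@le_trans _ _ (\sum_a \sum_b \sum_i
   (delta / (B + 1) * quad_form 1%:M v) * `|A i a b|)).
  apply: ler_sum => a _; apply: (le_trans (ler_norm_sum _ _ _)).
  apply: ler_sum => b _; rewrite mulrAC normrM.
  rewrite -mulr_sumr [leRHS]mulrAC [leRHS]mulrC.
  apply: ler_pM => //.
  rewrite mulr_sumr summxE.
  apply: (le_trans (ler_norm_sum _ _ _)); apply: ler_sum => i _.
  by rewrite mxE normrM ler_wpM2r.
have -> (kappa : R) : \sum_a \sum_b \sum_i kappa * `|A i a b| = kappa * B.
  transitivity (\sum_i \sum_a \sum_b kappa * `|A i a b|).
    by rewrite [RHS]exchange_big; apply: eq_bigr => a _; rewrite exchange_big.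
  rewrite mulr_sumr; apply: eq_bigr => i _.
  rewrite mulr_sumr; apply: eq_bigr => a _.
  by rewrite mulr_sumr.
rewrite mulrAC -!mulrA ler_pM2l // mulrA ler_piMl //.
by rewrite mulrC ler_pdivrMr ?mul1r ?lerDl // ltr_wpDl.
Qed.

(** Membership in the polar is a first-order formula: for all [x], if the form at [x] is nonnegative
    on all [v], then [inner c x <= 1]. *)
Lemma polar_spectrahedron_ideal :
  exists2 p, p != 0 & boundary_ideal (polar spectrahedron) p.
Proof.
(* Layout of the environment: [c] at indices below [k], then [x] on the next [k] indices, then [v]
   on the next [m]. *)
pose F (e : nat -> R) := \sum_(a < m) \sum_(b < m)
  e (k + k + a)%N * (A0 a b + \sum_(i < k) e (k + i)%N * A i a b) * e (k + k + b)%N.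
pose G (e : nat -> R) := \sum_(i < k) e i * e (k + i)%N.
pose Q e := (forall w, 0 <= F (update_range (k + k) m w e)) -> G e <= 1.
have dQ : definable Q.
  apply: definable_imp.
    apply: (@definable_forall _ (k + k) m (fun e => 0 <= F e)).
    apply: definable_le; first exact: polynomial_cst.
    do 2 (apply: polynomial_sum => ?).
    apply: polynomial_mul; last exact: polynomial_var.
    apply: polynomial_mul; first exact: polynomial_var.
    apply: polynomial_add; first exact: polynomial_cst.
    apply: polynomial_sum => ?.
    by apply: polynomial_mul; [apply: polynomial_var|apply: polynomial_cst].
  apply: definable_le; last exact: polynomial_cst.
  apply: polynomial_sum => ?.
  by apply: polynomial_mul; apply: polynomial_var.
have := definable_boundary_ideal (definable_forall k k dQ); apply => c.
pose row_of (n s : nat) (w : nat -> R) : 'rV[R]_n := \row_(i < n) w (s + i)%N.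
have GE w (e : nat -> R) : (forall i : 'I_k, e i = c 0 i) ->
    G (update_range k k w e) = inner c (row_of k k w).
  move=> ec; apply: eq_bigr => i _; rewrite mxE /update_range.
  have := ltn_ord i => ik; rewrite leqNgt ik /= leq_addr ltn_add2l ik.
  by rewrite ec.
have FE w w' (e : nat -> R) : F (update_range (k + k) m w' (update_range k k w e)) =
    quad_form (A0 + pencil (row_of k k w)) (row_of m (k + k)%N w').
  rewrite quad_formE; apply: eq_bigr => a _; apply: eq_bigr => b _.
  rewrite !mxE summxE /update_range !leq_addr !ltn_add2l !ltn_ord /=.
  congr (_ * (_ + _) * _); apply: eq_bigr => i _.
  have ik := ltn_ord i; rewrite !mxE leq_add2l leqNgt ik /=.
  by rewrite leq_addr ltn_add2l ik.
have ec (i : 'I_k) : nth 0 (row_env c) i = c 0 i.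
  by rewrite (nth_row_env c (ltn_ord i)); congr (c 0 _); apply/val_inj.
have surj (n s : nat) (v : 'rV[R]_n) : exists w, row_of n s w = v.
  exists (fun j => if insub (j - s)%N is Some i then v 0 i else 0).
  apply/rowP => i; rewrite mxE addKn; case: insubP => [j _ ji|].
    by congr (v 0 _); apply/val_inj.
  by rewrite ltn_ord.
split=> [h w|h x /spectrahedronP hx].
  rewrite /Q (GE _ _ ec) => hw; apply: h; apply/spectrahedronP => v.
  by have [w' <-] := surj m (k + k)%N v; rewrite -(FE w w' (nth 0 (row_env c))).
have [w xw] := surj k k x.
have := h w; rewrite /Q (GE _ _ ec) xw; apply => w'.
by rewrite FE xw.
Qed.

(* [U] spans part of the kernel of the matrix at [v]; moving away from [v] in any
   direction is seen on that kernel, so every functional close to minus the trace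
   of the compression to the kernel is maximal at [v]. *)
Lemma spectrahedron_vertex (r : nat) (U : 'M[R]_(r, m)) v :
  spectrahedron v -> U *m (A0 + pencil v) = 0 ->
  (forall z, U *m pencil z *m U^T = 0 -> z = 0) ->
  vertex spectrahedron v.
Proof.
move=> Sv Uv inj; split=> //.
pose T z := U *m pencil z *m U^T.
have TD z z' : T (z + z') = T z + T z' by rewrite /T pencilD mulmxDr mulmxDl.
have TZ t z : T (t *: z) = t *: T z.
  by rewrite /T pencilZ -scalemxAr -scalemxAl.
pose Phi : 'M[R]_(k, r * r) := \matrix_(i < k) mxvec (T (delta_mx 0 i)).
have PhiE z : z *m Phi = mxvec (T z).
  rewrite {2}(row_sum_delta z) mulmx_sum_row.
  have -> : T (\sum_j z 0 j *: delta_mx 0 j) = \sum_j z 0 j *: T (delta_mx 0 j).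
    elim/big_ind2: _ => [|a b a' b' <- <-|j _]; rewrite ?TD ?TZ //.
    by rewrite -(scale0r 0) TZ scale0r.
  rewrite linear_sum; apply: eq_bigr => i _.
  by rewrite linearZ /= rowK.
(* [Phi] is the matrix of [T]; injectivity provides [Psi], which recovers [z] linearly from
   [T z]. *)
have /row_freeP[Psi PP] : row_free Phi.
  rewrite -kermx_eq0; apply/rowV0P => z /sub_kermxP; rewrite PhiE => E.
  by apply: inj; apply: (can_inj mxvecK); rewrite E linear0.
pose c1 : 'rV[R]_k := \row_i - \tr (T (delta_mx 0 i)).
have c1E z : inner c1 z = - \tr (T z).
  rewrite {2}(row_sum_delta z).
  have -> : T (\sum_j z 0 j *: delta_mx 0 j) = \sum_j z 0 j *: T (delta_mx 0 j).
    elim/big_ind2: _ => [|a b a' b' <- <-|j _]; rewrite ?TD ?TZ //.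
    by rewrite -(scale0r 0) TZ scale0r.
  rewrite [\tr _]raddf_sum /= -sumrN; apply: eq_bigr => i _.
  by rewrite /= mxtraceZ mxE mulNr mulrC.
pose B := \sum_l \sum_i `|Psi l i|.
have B0 : 0 <= B by do 2 (apply: sumr_ge0 => ? _).
have B1 : 0 < B + 1 by rewrite ltr_wpDl.
(* Within this radius the change in [inner _ z] is at most [\tr (T z)], the amount by which [c1]
   decreases along [z]. *)
exists c1, (B + 1)^-1; split; first by rewrite invr_gt0.
move=> c bc x Sx; rewrite -subr_le0 -innerBr.
set z := x - v.
have zE : T z = U *m (A0 + pencil x) *m U^T.
  rewrite /T /z pencilB -[RHS]subr0 -(mul0mx _ U^T) -Uv -mulmxBl -mulmxBr.
  by congr (_ *m _ *m _); rewrite opprD addrACA subrr add0r.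
have Tpsd (w : 'rV[R]_r) : 0 <= (w *m T z *m w^T) 0 0.
  have /spectrahedronP/(_ (w *m U)) := Sx.
  by rewrite /quad_form zE trmx_mul !mulmxA.
have Tsym : (T z)^T = T z by rewrite /T !trmx_mul trmxK pencil_sym mulmxA.
have dd a b (M : 'M[R]_r) :
    (delta_mx 0 a *m M *m (delta_mx 0 b)^T : 'M[R]_1) 0 0 = M a b.
  rewrite trmx_delta -rowE -colE.
  by rewrite !mxE.
have diag a : 0 <= T z a a by have := Tpsd (delta_mx 0 a); rewrite dd.
have le_tr a : T z a a <= \tr (T z).
  by rewrite /mxtrace (bigD1 a) //= lerDl sumr_ge0.
(* Positivity on the sum and the difference of two basis vectors bounds an entry by the mean of two
   diagonal entries. *)
have offdiag a b : `|T z a b| <= \tr (T z).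
  have Tba : T z b a = T z a b by rewrite -[in LHS]Tsym mxE.
  pose f (u w : 'rV[R]_r) : R := (u *m T z *m w^T) 0 0.
  have fsym u w : f u w = f w u.
    have E : (u *m T z *m w^T)^T = w *m T z *m u^T.
      by rewrite trmx_mul trmxK trmx_mul Tsym mulmxA.
    by rewrite /f -E [RHS]mxE.
  have fl u u' t w : f (u + t *: u') w = f u w + t * f u' w.
    by rewrite /f !mulmxDl -!scalemxAl !mxE.
  have expand t : f (delta_mx 0 a + t *: delta_mx 0 b) (delta_mx 0 a + t *: delta_mx 0 b)
      = T z a a + t * (T z a b + T z a b) + t * t * T z b b.
    rewrite fl (fsym (delta_mx 0 a)) (fsym (delta_mx 0 b)) !fl /f !dd Tba; ring.
  have := le_tr a; have := le_tr b.
  have : 0 <= f _ _ := Tpsd (delta_mx 0 a + 1 *: delta_mx 0 b).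
  have : 0 <= f _ _ := Tpsd (delta_mx 0 a + (-1) *: delta_mx 0 b).
  rewrite !expand.
  rewrite ler_norml => *; apply/andP; split; lra.
have tr0 : 0 <= \tr (T z) by apply: sumr_ge0.
have dz d : inner d z = \sum_l mxvec (T z) 0 l * (Psi *m d^T) l 0.
  transitivity ((z *m d^T) 0 0).
    by rewrite innerC mxE; apply: eq_bigr => i _; rewrite [d^T _ _]mxE.
  by rewrite -[z in LHS]mulmx1 -PP mulmxA PhiE -mulmxA mxE.
have gl l : `|(Psi *m (c - c1)^T) l 0| <= (B + 1)^-1 * \sum_i `|Psi l i|.
  rewrite mxE; apply: (le_trans (ler_norm_sum _ _ _)); rewrite mulr_sumr.
  apply: ler_sum => i _; rewrite normrM mulrC ler_wpM2r //.
  have := ball_rVP i bc; rewrite !mxE distrC; exact: ltW.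
have mxv l : `|mxvec (T z) 0 l| <= \tr (T z).
  by case/mxvec_indexP: l => a b; rewrite mxvecE.
suff : inner (c - c1) z <= \tr (T z).
  by rewrite -[X in _ -> inner X _ <= _](subrK c1 c) (innerDl (c - c1)) c1E subr_le0.
rewrite dz; apply: (le_trans (ler_norm _)).
apply: (le_trans (ler_norm_sum _ _ _)).
apply: (@le_trans _ _ (\sum_l \tr (T z) * ((B + 1)^-1 * \sum_i `|Psi l i|))).
  by apply: ler_sum => l _; rewrite normrM ler_pM.
rewrite -mulr_sumr ler_piMr // -mulr_sumr -/B mulrC ler_pdivrMr // mul1r.
by rewrite lerDl.
Qed.

End Spectrahedron.

(** * The perturbed system of squares *)

HB.instance Definition _ (R : realType) (m n : nat) := Complete.on 'M[R]_(m, n).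

Section PerturbedSquares.
Variables (R : realType) (n : nat).
Let P := ('I_n * 'I_n)%type.
Variables (rho : P -> P -> R) (eps : R).
Hypotheses (rho_diag : forall s, rho s s = 1)
  (rho_off : forall s p, p != s -> 0 <= rho s p <= eps)
  (eps_small : eps * (n * n)%:R <= 16^-1).
Implicit Types (Y Z V : 'M[R]_n) (s p : P).

(** An entry of [rowsA Y *m (rowsB Z)^T] divided by the squared weight, see [rowsAB]; the term
    [p = s] is the main one. *)
Definition twisted_form Y Z s : R := \sum_p rho s p * (Y s.1 p.2 * Z p.1 s.2).

Definition off_diagonal Y Z s : R :=
  \sum_(p | p != s) rho s p * (Y s.1 p.2 * Z p.1 s.2).

Lemma twisted_formE Y Z s :
  twisted_form Y Z s = Y s.1 s.2 * Z s.1 s.2 + off_diagonal Y Z s.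
Proof. by rewrite /twisted_form (bigD1 s) //= rho_diag mul1r. Qed.

Lemma off_diagonal_bound s (F : P -> R) (M : R) : 0 <= M ->
  (forall p, `|F p| <= M) -> `|\sum_(p | p != s) rho s p * F p| <= M / 16.
Proof.
move=> M0 FM; apply: (le_trans (ler_norm_sum _ _ _)).
have eps0 : forall p, p != s -> 0 <= eps by move=> p /rho_off/andP[]; apply: le_trans.
apply: (@le_trans _ _ (\sum_(p | p != s) eps * M)).
  apply: ler_sum => p ps; have /andP[r0 r1] := rho_off ps.
  by rewrite normrM ger0_norm // ler_pM.
(* The sign of [eps] is known only when some [p] differs from [s]; otherwise the sum is empty. *)
have [->|/existsP[p ps]] : (\sum_(p | p != s) eps * M = 0) \/ [exists p, p != s].
- have [ex|nex] := boolP [exists p, p != s]; [by right|left].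
  rewrite big_pred0 // => p; apply: contraNF nex => ps; apply/existsP.
  by exists p.
- by rewrite divr_ge0.
have e0 := eps0 p ps.
apply: (@le_trans _ _ (\sum_(p : P) eps * M)).
  by rewrite [leRHS](bigD1 s) //= lerDr mulr_ge0.
rewrite sumr_const card_prod !card_ord -(mulr_natr (eps * M)) mulrAC mulrC.
by rewrite ler_wpM2l.
Qed.

Lemma mx_norm_le Y (M : R) : 0 <= M ->
  (forall s : P, `|Y s.1 s.2| <= M) -> `|Y| <= M.
Proof.
move=> M0 H; rewrite -[leLHS]/(mx_norm Y) mx_normrE; by apply/bigmax_leP.
Qed.

Lemma le_mx_norm Y i j : `|Y i j| <= `|Y|.
Proof.
rewrite -[leRHS]/(mx_norm Y) mx_normrE.
exact: (le_bigmax _ (fun ij : P => `|Y ij.1 ij.2|) (i, j)).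
Qed.

(** Banach's fixed point theorem. With the entries of [Y] written as signs times [1 + u], the system
    reads [2 u + u^2 + off_diagonal = 0], that is [f u = u]. *)
Lemma twisted_squares_solution (sigma : 'M[bool]_n) :
  exists Y, (forall s, twisted_form Y Y s = 1) /\
    forall i j, `|Y i j - (-1) ^+ sigma i j| <= 4^-1.
Proof.
pose U : set 'M[R]_n := [set u | forall i j, `|u i j| <= 4^-1].
pose Ym (u : 'M[R]_n) : 'M[R]_n := \matrix_(i, j) ((-1) ^+ sigma i j * (1 + u i j)).
pose f (u : 'M[R]_n) : 'M[R]_n :=
  \matrix_(i, j) (- (u i j ^+ 2 + off_diagonal (Ym u) (Ym u) (i, j)) / 2).
have sgn1 i j : `|(-1) ^+ sigma i j| = 1 :> R by rewrite normrX normrN1 expr1n.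
have Ym_le u i j : U u -> `|Ym u i j| <= 5 / 4.
  move=> Uu; rewrite mxE normrM sgn1 mul1r.
  by have := Uu i j; rewrite !ler_norml => /andP[h1 h2]; apply/andP; split; lra.
have Ym_sub u v i j : `|Ym u i j - Ym v i j| <= `|u - v|.
  rewrite !mxE -mulrBr normrM sgn1 mul1r opprD addrACA subrr add0r.
  by have := le_mx_norm (u - v) i j; rewrite !mxE.
have off_le u s : U u -> `|off_diagonal (Ym u) (Ym u) s| <= (5 / 4) * (5 / 4) / 16.
  move=> Uu; apply: off_diagonal_bound => [|p]; first by lra.
  by rewrite normrM ler_pM // Ym_le.
have off_lip u v s : U u -> U v ->
    `|off_diagonal (Ym u) (Ym u) s - off_diagonal (Ym v) (Ym v) s|
    <= (5 / 2 * `|u - v|) / 16.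
  move=> Uu Uv; rewrite /off_diagonal -sumrB.
  under eq_bigr do rewrite -mulrBr.
  apply: off_diagonal_bound => [|p]; first by rewrite mulr_ge0 //; lra.
  set a := Ym u _ _; set b := Ym u _ _; set c := Ym v _ _; set d := Ym v _ _.
  have -> : a * b - c * d = a * (b - d) + (a - c) * d by ring.
  apply: (le_trans (ler_normD _ _)); rewrite !normrM.
  have -> : 5 / 2 * `|u - v| = 5 / 4 * `|u - v| + `|u - v| * (5 / 4) by field.
  by apply: lerD; apply: ler_pM => //; first [apply: Ym_le|apply: Ym_sub].
have fU : {homo f : u / U u >-> U u}.
  move=> u Uu i j /=.
  rewrite mxE normrM normrN [`|2^-1|]gtr0_norm; last by lra.
  have h1 := off_le u (i, j) Uu.
  have h2 : `|u i j ^+ 2| <= 16^-1.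
    rewrite normrX; have := Uu i j; have := normr_ge0 (u i j); nra.
  have := ler_normD (u i j ^+ 2) (off_diagonal (Ym u) (Ym u) (i, j)).
  by move: h1 h2; lra.
have clU : closed U.
  have -> : U = \bigcap_(ij in [set: P]) [set u : 'M[R]_n | `|u ij.1 ij.2| <= 4^-1].
    apply/seteqP; split => u h; first by move=> [i j] _; apply: h.
    by move=> i j; apply: (h (i, j)).
  apply: closed_bigI => -[i j] _.
  apply: (@preimage_closed _ _ (fun u : 'M[R]_n => `|u i j|) [set z | z <= 4^-1]).
    move=> u _; apply: (@continuous_comp _ _ _ (fun u : 'M[R]_n => u i j) Num.norm).
      exact: coord_continuous.
    exact: norm_continuous.
  exact: closed_le.
have U0 : U !=set0.
  by exists 0 => i j; rewrite mxE normr0; lra.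
have q0 : (0 : R) <= 2^-1 by lra.
have ctr : is_contraction [fun of mkfun fU].
  (* The square contributes at most 1/4 to the Lipschitz constant and the off-diagonal part 5/64,
     below 1/2 together. *)
  exists (NngNum q0); split => /=; first by lra.
  move=> [u v] [/= Uu Uv]; apply: mx_norm_le; first by rewrite mulr_ge0.
  move=> [i j] /=; rewrite !mxE.
  have h1 := off_lip u v (i, j) Uu Uv.
  have h2 : `|u i j ^+ 2 - v i j ^+ 2| <= 2^-1 * `|u - v|.
    have -> : u i j ^+ 2 - v i j ^+ 2 = (u i j + v i j) * (u - v) i j.
      by rewrite !mxE; ring.
    rewrite normrM; apply: ler_pM => //; last exact: le_mx_norm.
    have := ler_normD (u i j) (v i j); have := Uu i j; have := Uv i j; lra.
  set a := off_diagonal _ _ _ in h1 *; set b := off_diagonal _ _ _ in h1 *.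
  have -> : - (u i j ^+ 2 + a) / 2 - - (v i j ^+ 2 + b) / 2 =
     - ((u i j ^+ 2 - v i j ^+ 2) + (a - b)) / 2 by field.
  rewrite normrM normrN [`|2^-1|]gtr0_norm; last by lra.
  have := ler_normD (u i j ^+ 2 - v i j ^+ 2) (a - b).
  have := normr_ge0 (u - v); move: h1 h2; lra.
have [u Uu uE] := banach_fixed_point ctr clU U0.
exists (Ym u); split => [[i j]|i j].
  rewrite twisted_formE /=.
  have := congr1 (fun M : 'M[R]_n => M i j) uE; rewrite /= /mkfun !mxE.
  set a := off_diagonal _ _ _ => E.
  have s2 : (-1) ^+ sigma i j * (-1) ^+ sigma i j = 1 :> R.
    by rewrite -expr2 sqrr_sign.
  rewrite mulrACA s2 mul1r.
  have -> : a = - 2 * u i j - u i j ^+ 2.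
    by apply: (mulIf (_ : 2^-1 != 0 :> R)); [rewrite invr_eq0 pnatr_eq0|lra].
  ring.
rewrite mxE mulrDr mulr1 addrAC subrr add0r normrM sgn1 mul1r; exact: Uu.
Qed.

(** The hypothesis on [V] says that the differential at [Y] of the quadratic map kills [V]. Its
    diagonal part [2 Y_s V_s] dominates, which gives [|V| <= |V| / 2]. *)
Lemma twisted_jacobian_injective Y V :
  (forall i j, 3 / 4 <= `|Y i j| <= 5 / 4) ->
  (forall s, twisted_form Y V s + twisted_form V Y s = 0) -> V = 0.
Proof.
move=> HY HV; apply/normr0_eq0/eqP; rewrite eq_le normr_ge0 andbT.
have key (s : P) : `|V s.1 s.2| <= 2^-1 * `|V|.
  have := HV s; rewrite !twisted_formE => E.
  have h : `|off_diagonal Y V s + off_diagonal V Y s| <= (5 / 2 * `|V|) / 16.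
    rewrite /off_diagonal -big_split /=.
    under eq_bigr do rewrite -mulrDr.
    apply: off_diagonal_bound => [|p]; first by rewrite mulr_ge0 //; lra.
    apply: (le_trans (ler_normD _ _)); rewrite !normrM.
    have -> : 5 / 2 * `|V| = 5 / 4 * `|V| + `|V| * (5 / 4) by field.
    have yle i j : `|Y i j| <= 5 / 4 by case/andP: (HY i j).
    by apply: lerD; apply: ler_pM => //; apply: le_mx_norm.
  have E' : 2 * (Y s.1 s.2 * V s.1 s.2) = - (off_diagonal Y V s + off_diagonal V Y s).
    by lra.
  have {}h : `|2 * (Y s.1 s.2 * V s.1 s.2)| <= (5 / 2 * `|V|) / 16.
    by rewrite E' normrN.
  rewrite !normrM [`|2|]gtr0_norm // in h.
  have /andP[y1 _] := HY s.1 s.2.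
  have : 3 / 4 * `|V s.1 s.2| <= `|Y s.1 s.2| * `|V s.1 s.2| by rewrite ler_wpM2r.
  have := normr_ge0 V; lra.
have := mx_norm_le (_ : 0 <= 2^-1 * `|V|) key; rewrite mulr_ge0 // => /(_ isT).
have := normr_ge0 V; lra.
Qed.

End PerturbedSquares.

(** * The spectrahedron with many vertices *)

Section SymmetricCoordinates.
Variables (R : realType) (m : nat).

Definition antisym_part (T : 'M[R]_m) : 'M[R]_m := T - T^T.

Lemma antisym_part_linear : linear antisym_part.
Proof.
move=> t T T'; rewrite /antisym_part linearD linearZ /= scalerBr.
by rewrite opprD addrACA.
Qed.

HB.instance Definition _ :=
  GRing.isLinear.Build R 'M[R]_m 'M[R]_m _ antisym_part antisym_part_linear.

(** The space of symmetric matrices as a kernel; a row basis of it supplies coordinates without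
    indexing the upper triangle. *)
Definition sym_kernel := kermx (lin_mx antisym_part).

Definition sym_dim : nat := \rank sym_kernel.

Definition sym_mx (x : 'rV[R]_sym_dim) : 'M[R]_m :=
  vec_mx (x *m row_base sym_kernel).

Lemma sym_mx_linear : linear sym_mx.
Proof. by move=> t x y; rewrite /sym_mx mulmxDl -scalemxAl linearP. Qed.

HB.instance Definition _ :=
  GRing.isLinear.Build R 'rV[R]_sym_dim 'M[R]_m _ sym_mx sym_mx_linear.

Lemma sym_mxT x : (sym_mx x)^T = sym_mx x.
Proof.
have : (x *m row_base sym_kernel <= sym_kernel)%MS.
  by apply: (submx_trans (submxMl _ _)); rewrite eq_row_base.
move=> /sub_kermxP; rewrite -[x *m _]vec_mxK mul_vec_lin => h.
have : antisym_part (sym_mx x) = 0.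
  by apply: (can_inj mxvecK); rewrite linear0.
by move/eqP; rewrite subr_eq0 => /eqP.
Qed.

Lemma sym_mx_inj x : sym_mx x = 0 -> x = 0.
Proof.
move=> E; have := row_base_free sym_kernel => /row_freeP[B BE].
rewrite -[x]mulmx1 -BE mulmxA -[x *m _]vec_mxK -/(sym_mx x) E.
by rewrite linear0 mul0mx.
Qed.

Lemma sym_mx_surj T : T^T = T -> exists x, sym_mx x = T.
Proof.
move=> Tsym; have : (mxvec T <= row_base sym_kernel)%MS.
  rewrite eq_row_base; apply/sub_kermxP; rewrite mul_vec_lin /=.
  by rewrite /antisym_part Tsym subrr linear0.
by case/submxP=> x E; exists x; rewrite /sym_mx -E mxvecK.
Qed.

Lemma sym_dim_gt0 : (0 < m)%N -> (0 < sym_dim)%N.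
Proof.
move=> m0; have [x xE] := sym_mx_surj (trmx1 R m).
rewrite lt0n; apply/eqP => d0; move: x xE; rewrite /sym_mx.
move: (row_base _); rewrite -/sym_dim d0 => B x.
rewrite (thinmx0 x) mul0mx linear0 => /matrixP/(_ (Ordinal m0) (Ordinal m0)).
by rewrite !mxE eqxx => /eqP; rewrite eq_sym oner_eq0.
Qed.

End SymmetricCoordinates.

(** * The pencil and its sign vertices *)

Section Construction.
Variables (R : realType) (n : nat).
Hypothesis n_gt0 : (0 < n)%N.
Let P := ('I_n * 'I_n)%type.
Implicit Types (Y Z V : 'M[R]_n) (s p : P).

Let eps : R := (16 * (n * n)%:R)^-1.

(** Adding [n] first keeps the truncated subtraction exact. *)
Definition weight (i j : 'I_n) : R := eps ^+ ((n + i - j) ^ 2)%N.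

(** The indicator says that the two factors share a column; the exponent is twice the squared
    distance of [s.2] and [p.2], written with truncated subtractions. *)
Definition rho s p : R :=
  (s.1 + p.2 == p.1 + s.2)%N%:R *
  eps ^+ (2 * ((s.2 - p.2 + (p.2 - s.2)) ^ 2))%N.

Let nn_gt0 : 0 < (n * n)%:R :> R.
Proof. by rewrite ltr0n muln_gt0 n_gt0. Qed.

Let eps_gt0 : 0 < eps.
Proof. by rewrite invr_gt0 mulr_gt0. Qed.

Let eps_le1 : eps <= 1.
Proof.
rewrite invf_le1 ?mulr_gt0 //.
have : 1 <= (n * n)%:R :> R by rewrite ler1n muln_gt0 n_gt0.
lra.
Qed.

Lemma rho_diag s : rho s s = 1.
Proof. by rewrite /rho eqxx subnn muln0 expr0 mulr1. Qed.

Lemma rho_off s p : p != s -> 0 <= rho s p <= eps.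
Proof.
move=> ps; rewrite /rho; case: eqP => [E|_]; last by rewrite mul0r lexx ltW.
rewrite mul1r exprn_ge0 ?(ltW eps_gt0) //=.
have d0 : (0 < s.2 - p.2 + (p.2 - s.2))%N.
  rewrite lt0n; apply: contraNneq ps => d0.
  have e2 : p.2 = s.2 by apply/val_inj => /=; lia.
  have e1 : p.1 = s.1 by apply/val_inj => /=; move: E; rewrite e2; lia.
  by rewrite [p]surjective_pairing [s]surjective_pairing e1 e2.
rewrite -[leRHS]expr1; apply: ler_wiXn2l; rewrite ?(ltW eps_gt0) //.
by rewrite muln_gt0 expn_gt0 d0.
Qed.

Lemma eps_small : eps * (n * n)%:R <= 16^-1.
Proof. by rewrite /eps invfM -mulrA mulVf ?mulr1 // gt_eqF. Qed.

(* Strict convexity of [x |-> x^2]: the product [w_ij * w_ij] beats the other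
   products of weights of the same column. *)
Lemma weight_rho (i j i' j' : 'I_n) : (i + j' = i' + j)%N ->
  weight i j' * weight i' j = weight i j ^+ 2 * rho (i, j) (i', j').
Proof.
move=> E; rewrite /rho /= E eqxx mul1r /weight -!exprM -!exprD; congr (_ ^+ _).
have := ltn_ord i; have := ltn_ord j; have := ltn_ord i'; have := ltn_ord j'.
move: (nat_of_ord i) (nat_of_ord j) (nat_of_ord i') (nat_of_ord j') E => a b c d.
move=> E hd hc hb ha.
(* In both cases the exponents obey [y^2 + (y + 2u)^2 = 2 (y + u)^2 + 2 u^2], where [u] is the
   shift. *)
case: (leqP b d) => bd.
  have [u ds] : exists u, d = (b + u)%N by exists (d - b)%N; lia.
  have [y ny] : exists y, (n + a)%N = (y + (b + u))%N by exists (n + a - d)%N; lia.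
  have -> : c = (a + u)%N by lia.
  rewrite ds ny; have -> : (n + (a + u) - b = y + 2 * u)%N by lia.
  have -> : (y + (b + u) - (b + u) = y)%N by lia.
  have -> : (y + (b + u) - b = y + u)%N by lia.
  have -> : (b - (b + u) + (b + u - b) = u)%N by lia.
  by rewrite !expnS !expn0; lia.
have [u ds] : exists u, b = (d + u)%N by exists (b - d)%N; lia.
have [y ny] : exists y, (n + c)%N = (y + (d + u))%N by exists (n + c - b)%N; lia.
have -> : a = (c + u)%N by lia.
rewrite ds; have -> : (n + (c + u) - d = y + 2 * u)%N by lia.
rewrite ny; have -> : (y + (d + u) - (d + u) = y)%N by lia.
have -> : (n + (c + u) - (d + u) = y + u)%N by lia.
have -> : (d + u - d + (d - (d + u)) = u)%N by lia.
by rewrite !expnS !expn0; lia.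
Qed.

Lemma weight_gt0 i j : 0 < weight i j.
Proof. by rewrite exprn_gt0. Qed.

Lemma weight_le1 i j : weight i j <= 1.
Proof. by rewrite exprn_ile1 // ltW. Qed.

(* The variable [Y i j] sits in column [i + j], in row [i] of [rowsA] and in
   row [j] of [rowsB]. *)
Definition rowsA Y : 'M[R]_(n, n + n) :=
  \matrix_(i < n, c < n + n) \sum_(j < n) (c == (i + j)%N :> nat)%:R * (weight i j * Y i j).

Definition rowsB Y : 'M[R]_(n, n + n) :=
  \matrix_(j < n, c < n + n) \sum_(i < n) (c == (i + j)%N :> nat)%:R * (weight i j * Y i j).

Lemma rowsAB Y Z i j :
  (rowsA Y *m (rowsB Z)^T) i j = weight i j ^+ 2 * twisted_form rho Y Z (i, j).
Proof.
have hc (a b : nat) : (a < n + n)%N ->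
    \sum_(c < n + n) (c == a :> nat)%:R * (c == b :> nat)%:R = (a == b)%:R :> R.
  move=> an; rewrite (bigD1 (Ordinal an)) //= eqxx mul1r big1 ?addr0 // => c ca.
  by rewrite -[_ == a]/(val c == val (Ordinal an)) val_eqE (negPf ca) mul0r.
rewrite mxE; under eq_bigr do rewrite !mxE big_distrlr /=.
rewrite exchange_big /=; under eq_bigr do rewrite exchange_big /=.
rewrite /twisted_form mulr_sumr exchange_big pair_big /=.
apply: eq_bigr => -[i' j'] _ /=.
transitivity (\sum_(c < n + n) ((c == (i + j')%N :> nat)%:R * (c == (i' + j)%N :> nat)%:R) *
   (weight i j' * weight i' j * (Y i j' * Z i' j))).
  by apply: eq_bigr => c _; ring.
rewrite -mulr_suml hc; last by rewrite -addnS leq_add // ltnW.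
have [E|NE] := eqVneq (i + j')%N (i' + j)%N; last first.
  by rewrite /rho /= (negPf NE) !mul0r mulr0.
by rewrite mul1r weight_rho // !mulrA.
Qed.

Definition rows Y : 'M[R]_(n + n) := col_mx (rowsA Y) (rowsB Y).

Lemma rows_linear t Y Z : rows (t *: Y + Z) = t *: rows Y + rows Z.
Proof.
rewrite /rows scale_col_mx add_col_mx; congr col_mx; apply/matrixP => i c;
  rewrite !mxE mulr_sumr -big_split; apply: eq_bigr => j _; rewrite !mxE /=; ring.
Qed.

Definition target : 'M[R]_n := \matrix_(i, j) weight i j ^+ 2.

(** The entries of [target] are at most 1, so a diagonal [n] already dominates them; [n.+1] leaves a
    full identity to spare and puts the origin in the interior. *)
Definition base_mx : 'M[R]_((n + n) + (n + n)) :=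
  block_mx 1%:M 0 0 (block_mx n.+1%:R%:M target target^T n.+1%:R%:M).

(** One symmetric [X] packs all the variables: its diagonal blocks shift the two symmetric unknowns,
    and its off-diagonal block is [Y], which enters only through [rows]. *)
Definition pencil_mx (X : 'M[R]_(n + n)) : 'M[R]_((n + n) + (n + n)) :=
  block_mx 0 (rows (ursubmx X))^T (rows (ursubmx X))
    (block_mx (ulsubmx X) 0 0 (drsubmx X)).

Lemma pencil_mx_linear : linear pencil_mx.
Proof.
move=> t X X'; rewrite /pencil_mx /ulsubmx /ursubmx /drsubmx !linearP /= rows_linear linearP /=.
by rewrite !(scale_block_mx, add_block_mx) !scaler0 !addr0.
Qed.

HB.instance Definition _ := GRing.isLinear.Build R 'M[R]_(n + n)
  'M[R]_((n + n) + (n + n)) _ pencil_mx pencil_mx_linear.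

Let k := sym_dim R (n + n).

Definition coef_mx (i : 'I_k) := pencil_mx (sym_mx (delta_mx 0 i)).

Lemma pencilE (x : 'rV[R]_k) : pencil coef_mx x = pencil_mx (sym_mx x).
Proof.
rewrite [in RHS](row_sum_delta x) !linear_sum; apply: eq_bigr => i _.
by rewrite !linearZ.
Qed.

Lemma base_mxT : base_mx^T = base_mx.
Proof. by rewrite /base_mx !tr_block_mx !tr_scalar_mx !trmx0 trmxK. Qed.

Lemma coef_mxT i : (coef_mx i)^T = coef_mx i.
Proof.
rewrite /coef_mx /pencil_mx !tr_block_mx trmxK !trmx0.
by rewrite trmx_ulsub trmx_drsub sym_mxT.
Qed.

(** Without the identity the form is a sum over [i, j] of [a_i^2 + 2 w^2 a_i b_j + b_j^2],
    nonnegative because [w^2 <= 1]. *)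
Lemma base_mx_ge1 (v : 'rV[R]_((n + n) + (n + n))) :
  1 * quad_form 1%:M v <= quad_form base_mx v.
Proof.
rewrite mul1r -subr_ge0 -mulN1r -quad_formZ -quad_formD.
have -> : base_mx + -1 *: 1%:M =
    block_mx 0 0 0 (block_mx n%:R%:M target target^T n%:R%:M).
  rewrite scaleN1r /base_mx [X in _ - X](scalar_mx_block _ _ 1).
  rewrite !(opp_block_mx, add_block_mx) !(subrr, oppr0, addr0).
  rewrite [X in _ - X](scalar_mx_block n n 1).
  rewrite !(opp_block_mx, add_block_mx) !(oppr0, addr0) -raddfB /=.
  by rewrite -natr1 addrK.
rewrite -[v]hsubmxK -[rsubmx v]hsubmxK; set u := lsubmx v.
move: (lsubmx (rsubmx v)) (rsubmx (rsubmx v)) => a b.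
rewrite /quad_form !(mul_row_block, tr_row_mx, mul_row_col, mulmx0, mul0mx,
  add0r, addr0).
rewrite !mul_mx_scalar !mulmxDl -!scalemxAl.
have qE (M : 'M[R]_n) (c d : 'rV[R]_n) :
    (c *m M *m d^T) 0 0 = \sum_i \sum_j c 0 i * M i j * d 0 j.
  rewrite mxE exchange_big /=; apply: eq_bigr => j _.
  by rewrite !mxE mulr_suml.
have dE (c : 'rV[R]_n) : (c *m c^T) 0 0 = \sum_i c 0 i ^+ 2.
  by rewrite mxE; apply: eq_bigr => i _; rewrite mxE.
have tE : (b *m target^T *m a^T) 0 0 = (a *m target *m b^T) 0 0.
  have E : (a *m target *m b^T)^T = b *m target^T *m a^T.
    by rewrite !trmx_mul trmxK mulmxA.
  by rewrite -E [LHS]mxE.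
have -> (A B C D : 'M[R]_1) : (n%:R *: A + B + (C + n%:R *: D)) 0 0 =
    n%:R * A 0 0 + B 0 0 + (C 0 0 + n%:R * D 0 0) by rewrite !mxE.
rewrite tE !dE qE.
have -> : n%:R * \sum_i a 0 i ^+ 2 = \sum_i \sum_(j < n) a 0 i ^+ 2.
  rewrite mulr_sumr; apply: eq_bigr => i _.
  by rewrite sumr_const card_ord mulr_natl.
have -> : n%:R * \sum_i b 0 i ^+ 2 = \sum_(i < n) \sum_j b 0 j ^+ 2.
  by rewrite [RHS]sumr_const card_ord mulr_natl.
rewrite -!big_split; apply: sumr_ge0 => i _ /=.
rewrite -!big_split; apply: sumr_ge0 => j _ /=; rewrite mxE.
have := weight_gt0 i j; have := weight_le1 i j; set w := weight i j => w1 w0.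
have e0 : 0 <= w ^+ 2 by rewrite sqr_ge0.
have e1 : w ^+ 2 <= 1 by rewrite exprn_ile1 // ltW.
have -> : a 0 i ^+ 2 + a 0 i * w ^+ 2 * b 0 j + (a 0 i * w ^+ 2 * b 0 j + b 0 j ^+ 2)
  = w ^+ 2 * (a 0 i + b 0 j) ^+ 2 + (1 - w ^+ 2) * (a 0 i ^+ 2 + b 0 j ^+ 2) by ring.
by rewrite addr_ge0 // mulr_ge0 ?sqr_ge0 ?subr_ge0 // addr_ge0 // sqr_ge0.
Qed.

Definition lift_body : set 'rV[R]_k := spectrahedron base_mx coef_mx.

Definition lift_vertex_mx Y : 'M[R]_(n + n) :=
  block_mx (rowsA Y *m (rowsA Y)^T - n.+1%:R%:M) Y
           Y^T (rowsB Y *m (rowsB Y)^T - n.+1%:R%:M).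

(** The matrix at [x] is [W *m W^T], and [row_mx (- rows Y) 1%:M] annihilates it. If the compression
    of a pencil to these rows is zero, its off-diagonal block gives [V = 0] by the Jacobian lemma,
    and then the diagonal blocks vanish too. *)
Lemma lift_body_vertex Y (x : 'rV[R]_k) :
  (forall s, twisted_form rho Y Y s = 1) ->
  (forall i j, 3 / 4 <= `|Y i j| <= 5 / 4) ->
  sym_mx x = lift_vertex_mx Y -> vertex lift_body x.
Proof.
move=> sol HY xE.
have YE : rowsA Y *m (rowsB Y)^T = target.
  by apply/matrixP => i j; rewrite rowsAB sol mulr1 mxE.
pose W := col_mx 1%:M (rows Y).
have ME : base_mx + pencil coef_mx x = W *m W^T.
  rewrite pencilE xE /pencil_mx /lift_vertex_mx block_mxKul block_mxKur block_mxKdr.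
  rewrite /base_mx !add_block_mx !addr0 !add0r !(addrC n.+1%:R%:M) !subrK.
  rewrite /W tr_col_mx mul_col_row trmx1 !mul1mx mulmx1; congr block_mx.
  rewrite /rows tr_col_mx mul_col_row YE; congr block_mx.
  by rewrite -YE trmx_mul trmxK.
apply: (@spectrahedron_vertex _ _ _ _ _ base_mxT coef_mxT _ (row_mx (- rows Y) 1%:M)).
- apply/(spectrahedronP base_mxT coef_mxT) => v; rewrite ME /quad_form.
  rewrite mulmxA -mulmxA -trmx_mul mxE; apply: sumr_ge0 => i _.
  by rewrite [X in _ * X]mxE -expr2 sqr_ge0.
- by rewrite ME mulmxA /W mul_row_col mulmx1 mul1mx addNr mul0mx.
move=> z; rewrite pencilE /pencil_mx; set V := ursubmx _.
rewrite mul_row_block tr_row_mx mul_row_col mulmx0 add0r mul1mx trmx1 mulmx1 mul1mx.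
set S := block_mx _ _ _ _ => E.
have VE : V = 0.
  apply: (twisted_jacobian_injective (rho := rho) (eps := eps)) HY _ => //.
  - exact: rho_diag.
  - exact: rho_off.
  - exact: eps_small.
  move=> [i j].
  have := congr1 (fun M : 'M[R]_(n + n) => ursubmx M i j) E.
  rewrite [(- _)^T]linearN /= mulmxN mulNmx /rows tr_col_mx tr_col_mx !mul_col_row.
  rewrite !(opp_block_mx, add_block_mx) block_mxKur addr0.
  rewrite 3![X in _ = X]mxE mxE [in X in X + _]mxE [in X in _ + X]mxE.
  rewrite !rowsAB -opprD => /eqP; rewrite oppr_eq0 -mulrDr mulf_eq0.
  rewrite expf_eq0 /= gt_eqF ?weight_gt0 //= => /eqP h.
  by rewrite addrC.
have rows0 : rows 0 = 0.
  by have := rows_linear (-1) 0 0; rewrite scaler0 addr0 scaleN1r addNr.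
have S0 : S = 0.
  by move: E; rewrite VE rows0 mul0mx trmx0 mulmx0 !add0r.
apply: sym_mx_inj; rewrite -[sym_mx z]submxK -/V VE.
have -> : dlsubmx (sym_mx z) = 0 by rewrite -sym_mxT -trmx_ursub -/V VE trmx0.
have := congr1 ulsubmx S0; rewrite /S block_mxKul => ->.
have := congr1 drsubmx S0; rewrite /S block_mxKdr => ->.
rewrite /ulsubmx /drsubmx !linear0.
exact: block_mx0.
Qed.

(** The clause on signs makes the vertices of different sign matrices distinct. *)
Lemma exists_sign_vertex (sigma : 'M[bool]_n) :
  exists x : 'rV[R]_k, vertex lift_body x /\
    forall i j, (ursubmx (sym_mx x) i j < 0) = sigma i j.
Proof.
have [Y [sol HY]] := twisted_squares_solution rho_diag rho_off eps_small sigma.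
have [x xE] : exists x, sym_mx x = lift_vertex_mx Y.
  apply: sym_mx_surj.
  by rewrite tr_block_mx trmxK !linearB /= !tr_scalar_mx !trmx_mul !trmxK.
exists x; split.
  apply: lift_body_vertex sol _ xE => i j; have := HY i j.
  have : `|(-1) ^+ sigma i j : R| = 1 by rewrite normrX normrN1 expr1n.
  set e := (-1) ^+ _ => e1 h.
  have h1 := ler_normD (Y i j - e) e.
  have h2 := ler_normD (e - Y i j) (Y i j).
  rewrite subrK in h1; rewrite subrK distrC in h2.
  by apply/andP; split; lra.
move=> i j; rewrite xE block_mxKur; have := HY i j.
case: (sigma i j) => /=; rewrite ?expr1 ?expr0 ler_norml => /andP[h1 h2].
  by apply/idP; lra.
by apply/negbTE; rewrite -leNgt; lra.
Qed.

Lemma lift_body_interior0 : interior lift_body 0.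
Proof.
exact: (spectrahedron_interior0 base_mxT coef_mxT ltr01 base_mx_ge1).
Qed.

End Construction.

Lemma psd_rank_exists (R : realType) (k : nat) (C : set 'rV[R]_k) (m : nat) :
  has_psd_lift C m -> exists2 r, is_psd_rank C r & (r <= m)%N.
Proof.
move=> Cm; have exP : exists r, `[< has_psd_lift C r >] by exists m; apply/asboolP.
case: (ex_minnP exP) => r /asboolP Cr minr; exists r.
  by split => // m' Cm'; apply: minr; apply/asboolP.
by apply: minr; apply/asboolP.
Qed.

(** [r^2 <= 16 n^2 <= 20 n^2 <= 20 log2 d]. *)
Lemma sqrt_log2_bound (R : realType) (n d r : nat) :
  (2 ^ (n * n) <= d)%N -> (r <= n + n + (n + n))%N ->
  r%:R <= Num.sqrt (20%:R * log2 (d%:R : R)).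
Proof.
move=> nd rn.
have ln2 : 0 < ln 2 :> R by rewrite ln_gt0 // ltr1n.
have d0 : (0 < d)%N by apply: leq_trans nd; rewrite expn_gt0.
have hd : (n * n)%:R <= log2 (d%:R : R).
  rewrite /log2 ler_pdivlMr // mulr_natl -lnXn // ler_ln ?posrE ?exprn_gt0 ?ltr0n //.
  by rewrite -natrX ler_nat.
have l0 : 0 <= 20%:R * log2 (d%:R : R) by rewrite mulr_ge0 // (le_trans _ hd).
rewrite -(@ler_pXn2r _ 2) ?nnegrE ?ler0n ?sqrtr_ge0 // sqr_sqrtr //.
apply: (@le_trans _ _ (20%:R * (n * n)%:R)); last by rewrite ler_wpM2l.
rewrite -natrX -natrM ler_nat; nia.
Qed.

Theorem theorem2 (R : realType) (D : nat) :
  exists (k : nat) (C : set 'rV[R]_k) (d r : nat),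
    [/\ (1 <= k)%N, convex_body C &
        is_hypersurface (algebraic_boundary (polar C))] /\
    [/\ has_degree (algebraic_boundary (polar C)) d,
        is_psd_rank C r,
        (D <= d)%N &
        r%:R <= Num.sqrt (20%:R * log2 (d%:R : R))].
Proof.
(* Positive, and large enough for [D <= n * n < 2 ^ (n * n)]. *)
pose n := D.+1; have n0 : (0 < n)%N by [].
have k0 : (0 < sym_dim R (n + n))%N by rewrite sym_dim_gt0 // addn_gt0 n0.
pose C := @lift_body R n.
have C0 : interior C 0 by apply: lift_body_interior0.
have [v vP] := boolp.choice (@exists_sign_vertex R n n0).
have vinj : injective v.
  move=> s t st; apply/matrixP => i j.
  by rewrite -(vP s).2 -(vP t).2 st.
have vv s : vertex C (v s) := (vP s).1.
have intK := polar_interior C0 k0 (vv (const_mx true)).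
have [hyp [d dP]] := algebraic_boundary_hypersurface (@polar_closed _ _ C)
  (@polar_convex _ _ C) intK (polar_neqT C0 k0)
  (polar_spectrahedron_ideal (base_mxT R n) (@coef_mxT R n)).
have [r rP rn] := psd_rank_exists
  (has_psd_lift_spectrahedron (base_mxT R n) (@coef_mxT R n)).
have nd : (2 ^ (n * n) <= d)%N.
  have [[p [p0 pI <-]] _] := dP.
  have := degree_ge_vertices C0 k0 vinj vv (introN eqP p0)
    ((vanishes_on_algebraic_boundary _ _).1 pI).
  by rewrite card_mx card_bool.
exists (sym_dim R (n + n)), C, d, r; split; split => //.
- split => //; first exact: (spectrahedron_closed (base_mxT R n) (@coef_mxT R n)).
  exact: (spectrahedron_convex (base_mxT R n) (@coef_mxT R n)).
- apply: leq_trans nd; apply: leq_trans (ltnW (ltn_expl _ _)) => //.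
  by rewrite /n; nia.
- exact: sqrt_log2_bound nd rn.
Qed.
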